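(* Let $f\in C(\Omega)$ with $f\ge 0$ in $\Omega$, and let $u$ be a viscosity solution of the Bellman equation $H(D^2u(x),f(x))=0$ in $\Omega$. Then $u$ is a viscosity solution of the Monge–Ampère equation $M(D^2u(x),f(x))=0$ in $\Omega$ on the set of convex functions (in particular $u$ is convex).
   Context: Let $d\ge 2$ and let $\Omega\subset\mathbb R^d$ be a bounded open strictly convex domain. $\mathbb S$ denotes the set of real symmetric $d\times d$ matrices, $\mathbb S_+=\{A\in\mathbb S: A\ge 0\}$ (positive semidefinite matrices), $\mathbb S_1=\{B\in\mathbb S_+:\operatorname{tr}B=1\}$, and $A:B=\operatorname{tr}(A^TB)$ is the Frobenius inner product. For $A\in\mathbb S$ and $f\in[0,\infty)$ define the Bellman operator $H(A,f)=\sup_{B\in\mathbb S_1}\bigl(-B:A+f\sqrt[d]{\det B}\bigr)$ and the Monge–Ampère operator $M(A,f)=(f/d)^d-\det A$. $\mathrm{USC}(G)$, $\mathrm{LSC}(G)$ denote upper/lower semicontinuous functions on $G$. Viscosity notions: for $F:\mathbb S\times\Omega\to\mathbb R$ (here $F(A,x)=H(A,f(x))$ or $F(A,x)=M(A,f(x))$), a function $u\in\mathrm{USC}(\Omega)$ (resp. $u\in\mathrm{LSC}(\Omega)$) is a viscosity subsolution (resp. supersolution) of $F(D^2u(x),x)=0$ in $\Omega$ if for every $\varphi\in C^2(\Omega)$ such that $u-\varphi$ has a local maximum (resp. minimum) at $x\in\Omega$ one has $F(D^2\varphi(x),x)\le 0$ (resp. $\ge 0$); a viscosity solution is both a sub-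 and a supersolution. The function $u$ is a viscosity subsolution (resp. supersolution) on the set of convex functions if $u$ is convex and the same inequality holds for every convex $\varphi\in C^2(\Omega)$ such that $u-\varphi$ has a local maximum (resp. minimum) at $x\in\Omega$; a viscosity solution on the set of convex functions is both. *)

(* Defs.v *)
(* Stdlib reals [R], equipped below with MathComp ring/field
   structures so that MathComp matrices ('M[R]_d, \det, \tr, *m, ^T) can be
   used over the classical real numbers. *)
From HB Require Import structures.
From mathcomp Require Import all_boot all_order all_algebra.
From Stdlib Require Import Reals Lra ClassicalEpsilon FunctionalExtensionality.
Set Implicit Arguments.
Unset Strict Implicit.
Unset Printing Implicit Defensive.

Definition R_eqb (x y : R) : bool := if Req_EM_T x y then true else false.
Lemma R_eqP : Equality.axiom R_eqb.
Proof. move=> x y; rewrite /R_eqb; case: Req_EM_T => h; constructor => //. Qed.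
HB.instance Definition _ := hasDecEq.Build R R_eqP.

Definition R_find (P : pred R) (n : nat) : option R :=
  match excluded_middle_informative (exists x, P x) with
  | left h => Some (proj1_sig (constructive_indefinite_description _ h))
  | right _ => None
  end.
Lemma R_find_correct P n x : R_find P n = Some x -> P x.
Proof.
rewrite /R_find; case: excluded_middle_informative => // h [<-].
exact: proj2_sig (constructive_indefinite_description _ h).
Qed.
Lemma R_find_complete (P : pred R) : (exists x, P x) -> exists n, R_find P n.
Proof. move=> h; exists 0%N; rewrite /R_find; case: excluded_middle_informative => //. Qed.
Lemma R_find_ext (P Q : pred R) : P =1 Q -> R_find P =1 R_find Q.
Proof. move=> /functional_extensionality -> //. Qed.
HB.instance Definition _ :=
  hasChoice.Build R R_find_correct R_find_complete R_find_ext.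

Lemma R_addA : associative Rplus. Proof. move=> *; ring. Qed.
Lemma R_addC : commutative Rplus. Proof. move=> *; ring. Qed.
Lemma R_add0 : left_id 0%R Rplus. Proof. move=> *; ring. Qed.
Lemma R_addN : left_inverse 0%R Ropp Rplus. Proof. move=> *; ring. Qed.
HB.instance Definition _ := GRing.isZmodule.Build R R_addA R_addC R_add0 R_addN.

Lemma R_mulA : associative Rmult. Proof. move=> *; ring. Qed.
Lemma R_mulC : commutative Rmult. Proof. move=> *; ring. Qed.
Lemma R_mul1 : left_id 1%R Rmult. Proof. move=> *; ring. Qed.
Lemma R_mulD : left_distributive Rmult Rplus. Proof. move=> *; ring. Qed.
Lemma R_one_neq0 : (1%R : R) != 0%R.
Proof. apply/eqP; exact: R1_neq_R0. Qed.
HB.instance Definition _ :=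
  GRing.Zmodule_isComNzRing.Build R R_mulA R_mulC R_mul1 R_mulD R_one_neq0.

Lemma R_mulV (x : R) : x != 0%R -> (Rinv x * x = 1)%R.
Proof. move/eqP=> h; exact: Rinv_l. Qed.
HB.instance Definition _ := GRing.ComNzRing_isField.Build R R_mulV Rinv_0.

Notation pt d := 'rV[R]_d.
Notation mat d := 'M[R]_d.

Local Open Scope ring_scope.
Definition lincomb (d : nat) (t : R) (x : pt d) (s : R) (y : pt d) : pt d :=
  t *: x + s *: y.
Definition shift (d : nat) (x : pt d) (t : R) (i : 'I_d) : pt d :=
  x + t *: delta_mx ord0 i.
Definition symmetric (d : nat) (A : mat d) : Prop := A^T = A.
Definition quad (d : nat) (v : 'rV[R]_d) (A : mat d) : R := (v *m A *m v^T) ord0 ord0.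
Definition frob (d : nat) (A B : mat d) : R := \tr (A^T *m B).
Local Close Scope ring_scope.

Local Open Scope R_scope.

(* sup-norm ball condition: |y_k - x_k| < r for all k (same topology as the
   Euclidean one). *)
Definition near (d : nat) (x y : pt d) (r : R) : Prop :=
  forall k : 'I_d, Rabs (y ord0 k - x ord0 k) < r.

Definition is_open (d : nat) (Om : pt d -> Prop) : Prop :=
  forall x, Om x -> exists r, 0 < r /\ forall y, near x y r -> Om y.

Definition is_bounded (d : nat) (Om : pt d -> Prop) : Prop :=
  exists M, forall x, Om x -> forall k : 'I_d, Rabs (x ord0 k) <= M.

Definition closure (d : nat) (Om : pt d -> Prop) (z : pt d) : Prop :=
  forall eps, 0 < eps -> exists w, Om w /\ near z w eps.

Definition strictly_convex (d : nat) (Om : pt d -> Prop) : Prop :=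
  forall x y, closure Om x -> closure Om y -> x <> y ->
  forall t, 0 < t < 1 -> Om (lincomb t x (1 - t) y).

Definition convex_on (d : nat) (Om : pt d -> Prop) (g : pt d -> R) : Prop :=
  forall x y, Om x -> Om y -> forall t, 0 <= t <= 1 ->
  g (lincomb t x (1 - t) y) <= t * g x + (1 - t) * g y.

Definition cont_on (d : nat) (Om : pt d -> Prop) (g : pt d -> R) : Prop :=
  forall x, Om x -> forall eps, 0 < eps -> exists delta, 0 < delta /\
  forall y, Om y -> near x y delta -> Rabs (g y - g x) < eps.

Definition usc_on (d : nat) (Om : pt d -> Prop) (g : pt d -> R) : Prop :=
  forall x, Om x -> forall eps, 0 < eps -> exists delta, 0 < delta /\
  forall y, Om y -> near x y delta -> g y < g x + eps.

Definition lsc_on (d : nat) (Om : pt d -> Prop) (g : pt d -> R) : Prop :=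
  forall x, Om x -> forall eps, 0 < eps -> exists delta, 0 < delta /\
  forall y, Om y -> near x y delta -> g x - eps < g y.

Definition loc_max (d : nat) (Om : pt d -> Prop) (g : pt d -> R) (x : pt d) :=
  exists r, 0 < r /\ forall y, Om y -> near x y r -> g y <= g x.

Definition loc_min (d : nat) (Om : pt d -> Prop) (g : pt d -> R) (x : pt d) :=
  exists r, 0 < r /\ forall y, Om y -> near x y r -> g x <= g y.

Definition pderiv (d : nat) (g : pt d -> R) (i : 'I_d) (x : pt d) (l : R) :=
  derivable_pt_lim (fun t => g (shift x t i)) 0 l.

Definition C2_on (d : nat) (Om : pt d -> Prop) (g : pt d -> R)
    (Dg : 'I_d -> pt d -> R) (D2g : 'I_d -> 'I_d -> pt d -> R) : Prop :=
  cont_on Om g /\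
  (forall i, cont_on Om (Dg i)) /\
  (forall i j, cont_on Om (D2g i j)) /\
  (forall i x, Om x -> pderiv g i x (Dg i x)) /\
  (forall i j x, Om x -> pderiv (Dg i) j x (D2g i j x)).

Definition hessian (d : nat) (D2g : 'I_d -> 'I_d -> pt d -> R) (x : pt d)
  : mat d := \matrix_(i, j) D2g i j x.

Definition psd (d : nat) (A : mat d) : Prop :=
  symmetric A /\ forall v : 'rV[R]_d, 0 <= quad v A.
Definition S1 (d : nat) (B : mat d) : Prop := psd B /\ mxtrace B = 1.


Definition droot (d : nat) (x : R) : R :=
  if Rlt_dec 0 x then Rpower x (/ INR d) else 0.

Definition Hset (d : nat) (A : mat d) (f : R) : R -> Prop :=
  fun r => exists B : mat d, S1 B /\ r = - frob B A + f * droot d (determinant B).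
Definition Hop (d : nat) (A : mat d) (f : R) : R :=
  epsilon (inhabits 0) (is_lub (Hset A f)).

Definition Mop (d : nat) (A : mat d) (f : R) : R := (f / INR d) ^ d - determinant A.

Definition visc_sub (d : nat) (Om : pt d -> Prop) (F : mat d -> pt d -> R)
    (u : pt d -> R) : Prop :=
  usc_on Om u /\
  forall phi Dphi D2phi x, C2_on Om phi Dphi D2phi -> Om x ->
    loc_max Om (fun y => u y - phi y) x -> F (hessian D2phi x) x <= 0.

Definition visc_super (d : nat) (Om : pt d -> Prop) (F : mat d -> pt d -> R)
    (u : pt d -> R) : Prop :=
  lsc_on Om u /\
  forall phi Dphi D2phi x, C2_on Om phi Dphi D2phi -> Om x ->
    loc_min Om (fun y => u y - phi y) x -> 0 <= F (hessian D2phi x) x.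

Definition visc_sol (d : nat) (Om : pt d -> Prop) (F : mat d -> pt d -> R)
    (u : pt d -> R) : Prop := visc_sub Om F u /\ visc_super Om F u.

Definition visc_sub_cvx (d : nat) (Om : pt d -> Prop) (F : mat d -> pt d -> R)
    (u : pt d -> R) : Prop :=
  usc_on Om u /\ convex_on Om u /\
  forall phi Dphi D2phi x, C2_on Om phi Dphi D2phi -> convex_on Om phi ->
    Om x -> loc_max Om (fun y => u y - phi y) x -> F (hessian D2phi x) x <= 0.

Definition visc_super_cvx (d : nat) (Om : pt d -> Prop) (F : mat d -> pt d -> R)
    (u : pt d -> R) : Prop :=
  lsc_on Om u /\ convex_on Om u /\
  forall phi Dphi D2phi x, C2_on Om phi Dphi D2phi -> convex_on Om phi ->
    Om x -> loc_min Om (fun y => u y - phi y) x -> 0 <= F (hessian D2phi x) x.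

Definition visc_sol_cvx (d : nat) (Om : pt d -> Prop) (F : mat d -> pt d -> R)
    (u : pt d -> R) : Prop := visc_sub_cvx Om F u /\ visc_super_cvx Om F u.

(* Main.v *)
(** If [H(D^2 phi, f) <= 0], rank-one test matrices [B] give [D^2 phi >= 0] at every
    point where [phi] touches [u] from above, and a semicontinuous function with this
    property is convex: otherwise the maximum over a thin tube around a segment of [u]
    minus a quadratic that is concave along the segment and steep across it would be
    interior.  For [A > 0] the matrix [B = A^-1 / tr A^-1] turns [H(A, f) <= 0] into
    [(f/d)^d <= det A]; a singular [A >= 0] is the limit of [A + t I].  Conversely the
    inequality [d (det A det B)^(1/d) <= B : A], a consequence of Hadamard's inequality,
    shows that [(f/d)^d < det A] makes the supremum defining [H(A, f)] negative. *)
Require Import Defs.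
From HB Require Import structures.
From mathcomp Require Import all_boot all_order all_algebra.
From Stdlib Require Import Reals Lra ClassicalEpsilon FunctionalExtensionality.
Set Implicit Arguments.
Unset Strict Implicit.
Unset Printing Implicit Defensive.
Import Order.TTheory GRing.Theory Num.Theory.

(** * Positive semidefinite matrices *)

Section PosSemidef.
Local Open Scope ring_scope.
Context {F : realFieldType}.

(** The matrix theory lives over an arbitrary real field, which need not contain square roots or
    eigenvalues. The factorization [C = L D L^T] with [L] unit lower triangular replaces the
    spectral theorem: it exists for singular [C] too, and [\det L = 1] makes [\det C] the product of
    the entries of [D]. Roots are avoided by comparing [n]-th powers.

    The two halves of the theorem are not symmetric. For subsolutions the inequality for [H] itself
    forces the Hessian to be positive semidefinite. For supersolutions it does not: with [f = 0],
    [A = -I] and [d] even, [H = 1] but [M = -1]. There the convexity of the test function supplies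
    the sign. Moreover a supremum of negative numbers may be 0, so the bracket in [H] has to be
    bounded away from 0 uniformly over [S1]. *)

Definition psdmx n (A : 'M[F]_n) : Prop :=
  A^T = A /\ forall v : 'rV_n, 0 <= (v *m A *m v^T) 0 0.

Lemma psdmx_congr n m (A : 'M[F]_n) (L : 'M_(m, n)) :
  psdmx A -> psdmx (L *m A *m L^T).
Proof.
case=> sA pA; split; first by rewrite !trmx_mul sA trmxK mulmxA.
move=> v; have := pA (v *m L).
by rewrite trmx_mul !mulmxA.
Qed.

Lemma psdmx_diag_ge0 n (A : 'M[F]_n) i : psdmx A -> 0 <= A i i.
Proof.
case=> _ /(_ (delta_mx 0 i)).
by rewrite -rowE trmx_delta -colE !mxE.
Qed.

Lemma psdmx_pair n (A : 'M[F]_n) i j x : psdmx A ->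
  0 <= x ^+ 2 * A i i + (x * A i j) *+ 2 + A j j.
Proof.
case=> sA /(_ (x *: delta_mx 0 i + delta_mx 0 j)).
rewrite linearD linearZ /= !trmx_delta mulmxDl mulmxDr !mulmxDl.
rewrite -!scalemxAl -!scalemxAr -!rowE -!colE !mxE.
have -> : A j i = A i j by rewrite -[in LHS]sA mxE.
by rewrite mulrA -expr2 addrA mulr2n addrA.
Qed.

(** With [A i i = 0] the expression in [psdmx_pair] is affine in [x] with slope [2 A i j]. A nonzero
    slope would allow the value -1, reached at the chosen [x]. *)
Lemma psdmx_diag0 n (A : 'M[F]_n) i j : psdmx A -> A i i = 0 -> A i j = 0.
Proof.
move=> pA a0; case: (eqVneq (A i j) 0) => // nz.
have := psdmx_pair i j (- (A j j + 1) / (A i j *+ 2)) pA.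
have nz2 : A i j *+ 2 != 0 by rewrite mulrn_eq0.
rewrite a0 mulr0 add0r -mulrnAr mulfVK // opprD addrAC addNr add0r.
by rewrite oppr_ge0 ler10.
Qed.

(** Testing with [x = 1] and [x = -1] in [psdmx_pair] bounds twice the entry by [C i i + C j j], and
    each diagonal entry is at most the trace. *)
Lemma psdmx_entry_le n (C : 'M[F]_n) i j : psdmx C -> `|C i j| <= \tr C.
Proof.
move=> pC; have d0 k : 0 <= C k k by exact: psdmx_diag_ge0.
have dt k : C k k <= \tr C by rewrite /mxtrace (bigD1 k) //= lerDl sumr_ge0.
have /= := psdmx_pair i j 1 pC; have /= := psdmx_pair i j (-1) pC.
rewrite sqrrN expr1n !mul1r mulN1r ler_norml; have := dt i; have := dt j.
move: (C i j) (C i i) (C j j) (\tr C) => x y z t zt yt.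
have yz : y + z <= t *+ 2 by rewrite mulr2n lerD.
rewrite mulNrn !(addrAC _ _ z) (addrC _ (- _)) addrC subr_ge0 => h1.
rewrite -[x *+ 2]opprK subr_ge0 => h2.
rewrite -[X in X && _](ler_pMn2r (ltn0Sn 1)) -[X in _ && X](ler_pMn2r (ltn0Sn 1)).
by rewrite mulNrn lerNl (le_trans h2 yz) (le_trans h1 yz).
Qed.

(** Block elimination: the corner entry is the pivot and the induction hypothesis factors the Schur
    complement. Zeros are allowed in [D], so that singular matrices are covered. *)
Lemma psdmx_ldl n (C : 'M[F]_n) : psdmx C ->
  exists (L : 'M_n) (D : 'rV_n),
  [/\ C = L *m diag_mx D *m L^T, is_trig_mx L, forall i, L i i = 1
    & forall i, 0 <= D 0 i].
Proof.
elim: n C => [|n IH] C pC.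
  exists 0, 0; split; [| |by case|by case].
    by apply/matrixP; case.
  by apply/is_trig_mxP; case.
move: C pC; rewrite -[n.+1]/(1 + n)%nat => C pC.
pose a := C 0 0; pose b : 'rV_n := ursubmx C; pose S : 'M_n := drsubmx C.
have eC : C = block_mx a%:M b b^T S.
  rewrite -[LHS]submxK; congr block_mx.
    by apply/matrixP=> i j; rewrite !ord1 !mxE /= mulr1n; congr (C _ _); apply: val_inj.
  by rewrite /b trmx_ursub pC.1.
have a0 : 0 <= a by exact: psdmx_diag_ge0.
(* For [a = 0] (where [a^-1 = 0]) the whole first row of [C] vanishes, so the Schur
   complement below needs no case distinction. *)
have ab : (a * a^-1) *: b = b.
  case: (eqVneq a 0) => [z|nz]; last by rewrite mulfV // scale1r.
  have -> : b = 0.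
    by apply/rowP=> j; rewrite /b !mxE; apply: psdmx_diag0 => //; rewrite -z;
       congr (C _ _); apply: val_inj.
  by rewrite scaler0.
pose S' := S - a^-1 *: (b^T *m b).
pose M : 'M_(1 + n) := block_mx 1%:M 0 (a^-1 *: b^T) 1%:M.
have eC2 : C = M *m block_mx a%:M 0 0 S' *m M^T.
  rewrite /M tr_block_mx !mulmx_block eC !tr_scalar_mx !trmx0 linearZ /= trmxK.
  rewrite !(mulmx0, mul0mx, mulmx1, mul1mx, addr0, add0r).
  rewrite -scalemxAr mul_scalar_mx scalerA mulrC ab.
  rewrite mul_mx_scalar scalerA.
  have ->: (a * a^-1) *: b^T = b^T by rewrite -linearZ ab.
  congr block_mx; by rewrite -scalemxAr /S' addrC subrK.
have pS : psdmx S'.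
  split.
    have := pC.1; rewrite eC tr_block_mx => /eq_block_mx[_ _ _ sS].
    by rewrite /S' linearB linearZ /= trmx_mul trmxK sS.
  (* The first coordinate is chosen so that [M] sends the vector to [(0, v)]; the form of [C] there
     is the form of [S'] at [v]. *)
  move=> v; have := pC.2 (row_mx (- (a^-1 *: (v *m b^T))) v).
  have Mv : row_mx (- (a^-1 *: (v *m b^T))) v *m M = row_mx 0 v.
    by rewrite mul_row_block !mulmx0 !mulmx1 add0r -scalemxAr addNr.
  rewrite eC2 !mulmxA Mv -mulmxA -trmx_mul Mv.
  rewrite mul_row_block tr_row_mx mul_row_col !mulmx0 !mul0mx !add0r.
  by rewrite trmx0 mulmx0 add0r.
have [L [D [eS tL L1 D0]]] := IH _ pS.
exists (block_mx 1%:M 0 (a^-1 *: b^T) L), (row_mx a%:M D); split.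
- have -> : block_mx 1%:M 0 (a^-1 *: b^T) L = M *m block_mx 1%:M 0 0 L.
    by rewrite mulmx_block !(mulmx0, mul0mx, mulmx1, mul1mx, addr0, add0r).
  rewrite eC2 trmx_mul !mulmxA; congr (_ *m _); rewrite -!mulmxA; congr (_ *m _).
  rewrite diag_mx_row tr_block_mx !mulmx_block.
  rewrite !trmx0 trmx1 !(mulmx0, mul0mx, mulmx1, mul1mx, addr0, add0r).
  rewrite mulmxA -eS; congr block_mx.
  by apply/matrixP=> i j; rewrite !ord1 !mxE eqxx.
- by rewrite is_trig_block_mx // eqxx tL scalar_mx_is_trig.
- move=> i; case: (split_ordP i) => j ->.
    by rewrite block_mxEul !mxE eqxx.
  by rewrite block_mxEdr L1.
- move=> i; case: (split_ordP i) => j ->.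
    by rewrite row_mxEl !mxE ord1 eqxx.
  by rewrite row_mxEr D0.
Qed.

Lemma det_unitrig n (L : 'M[F]_n) :
  is_trig_mx L -> (forall i, L i i = 1) -> \det L = 1.
Proof. by move=> tL L1; rewrite det_trig // big1. Qed.

Lemma det_ldl n (L : 'M[F]_n) (D : 'rV_n) :
  is_trig_mx L -> (forall i, L i i = 1) ->
  \det (L *m diag_mx D *m L^T) = \prod_i D 0 i.
Proof.
by move=> tL L1; rewrite !det_mulmx det_tr det_unitrig // mul1r mulr1 det_diag.
Qed.

Lemma psdmx_det_ge0 n (A : 'M[F]_n) : psdmx A -> 0 <= \det A.
Proof.
move=> /psdmx_ldl[L [D [-> tL L1 D0]]].
by rewrite det_ldl // prodr_ge0.
Qed.

(** Since [L i i = 1], the entry [C i i] is [D i] plus a sum of terms [D j] times a square, hence at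
    least [D i]. *)
Lemma hadamard_psdmx n (C : 'M[F]_n) : psdmx C -> \det C <= \prod_i C i i.
Proof.
move=> /psdmx_ldl[L [D [-> tL L1 D0]]].
rewrite det_ldl //; apply: ler_prod => i _; rewrite D0 /=.
rewrite !mxE (bigD1 i) //= mul_mx_diag !mxE L1 mul1r mulr1 lerDl.
apply: sumr_ge0 => j _; rewrite !mxE mulrAC -expr2.
by rewrite mulr_ge0 // sqr_ge0.
Qed.

(** The transpose is left as [L^T^T] so that the congruence has the shape of [psdmx_congr] at
    [L^T]. *)
Lemma mxtrace_mul_ldl n (L B : 'M[F]_n) (D : 'rV_n) :
  \tr (L *m diag_mx D *m L^T *m B) = \sum_i D 0 i * (L^T *m B *m L^T^T) i i.
Proof.
rewrite trmxK -!mulmxA mxtrace_mulC -!mulmxA; apply: eq_bigr => i _.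
by rewrite mul_diag_mx mxE.
Qed.

Lemma psdmx_frob_ge0 n (A B : 'M[F]_n) : psdmx A -> psdmx B -> 0 <= \tr (A *m B).
Proof.
move=> /psdmx_ldl[L [D [-> tL L1 D0]]] pB.
rewrite mxtrace_mul_ldl sumr_ge0 // => i _.
by rewrite mulr_ge0 //; exact/psdmx_diag_ge0/psdmx_congr.
Qed.

(** The arithmetic-geometric mean inequality is applied to the numbers [D i * C i i] with
    [C = L^T B L]. Their sum is [\tr (A B)], and by Hadamard their product is at least
    [\det A * \det C = \det A * \det B]. *)
Lemma psdmx_agm n (A B : 'M[F]_n) : psdmx A -> psdmx B ->
  \det A * \det B * n%:R ^+ n <= \tr (A *m B) ^+ n.
Proof.
case: n A B => [|n] A B pA pB; first by rewrite !det_mx00 !mulr1 expr0.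
have [L [D [eA tL L1 D0]]] := psdmx_ldl pA.
have pC := psdmx_congr L^T pB; set C := _ *m _ *m _ in pC.
have E0 i : 0 <= D 0 i * C i i by rewrite mulr_ge0 // psdmx_diag_ge0.
have := leif_AGM (A := 'I_n.+1) (E := fun i => D 0 i * C i i) (fun i _ => E0 i).
move=> /leifP; rewrite card_ord => H.
have {}H : \prod_i (D 0 i * C i i) <= ((\sum_i D 0 i * C i i) / n.+1%:R) ^+ n.+1.
  by move: H; case: ifP => _; [move=> /eqP->|move=> /ltW].
rewrite eA mxtrace_mul_ldl -/C -ler_pdivlMr ?exprn_gt0 ?ltr0n // -expr_div_n.
apply: le_trans H; rewrite big_split /= det_ldl //.
apply: ler_wpM2l; first exact: prodr_ge0.
have -> : \det B = \det C.
  by rewrite /C !det_mulmx !det_tr (det_unitrig tL) // mul1r mulr1.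
exact: hadamard_psdmx.
Qed.

(** The inverse equals [A^-1 A (A^-1)^T], a congruence of [A]. *)
Lemma psdmx_invmx n (A : 'M[F]_n) : A \in unitmx -> psdmx A -> psdmx (invmx A).
Proof.
move=> uA pA; have sI : (invmx A)^T = invmx A by rewrite trmx_inv pA.1.
by rewrite -[X in psdmx X]mulmx1 -[X in _ *m X](mulmxV uA) mulmxA -{2}sI;
   exact: psdmx_congr.
Qed.

Lemma psdmx1 n : psdmx (1%:M : 'M[F]_n).
Proof.
split=> [|v]; first exact: trmx1.
rewrite mulmx1 mxE sumr_ge0 // => i _; rewrite mxE -expr2; exact: sqr_ge0.
Qed.

Lemma psdmx_tr_ge0 n (A : 'M[F]_n) : psdmx A -> 0 <= \tr A.
Proof. by move=> pA; apply: sumr_ge0 => i _; apply: psdmx_diag_ge0. Qed.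

(** A zero trace would make [\det A^-1] nonpositive by [psdmx_agm] against the identity, but it is
    nonnegative and nonzero. *)
Lemma psdmx_tr_inv_gt0 n (A : 'M[F]_n) :
  (0 < n)%nat -> A \in unitmx -> psdmx A -> 0 < \tr (invmx A).
Proof.
case: n A => // n A _ uA /(psdmx_invmx uA) pI.
rewrite lt_neqAle psdmx_tr_ge0 // andbT eq_sym.
apply/eqP=> t0; have := psdmx_agm pI (psdmx1 n.+1).
rewrite mulmx1 t0 expr0n /= det1 mulr1 pmulr_lle0 ?exprn_gt0 ?ltr0n //.
rewrite leNgt lt_neqAle psdmx_det_ge0 // andbT eq_sym -unitfE.
by rewrite -[_ \is a _]/(invmx A \in unitmx) unitmx_inv uA.
Qed.

Lemma psdmx_add_scalar n (A : 'M[F]_n) (x : F) : 0 < x -> psdmx A ->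
  psdmx (A + x%:M) /\ 0 < \det (A + x%:M).
Proof.
move=> x0 pA.
have q (v : 'rV[F]_n) : (v *m (A + x%:M) *m v^T) 0 0 =
    (v *m A *m v^T) 0 0 + x * \sum_i v 0 i ^+ 2.
  rewrite mulmxDr mulmxDl mxE mul_mx_scalar -scalemxAl [in X in _ + X]mxE.
  by congr (_ + _ * _); rewrite mxE; apply: eq_bigr => i _; rewrite mxE expr2.
have s0 (v : 'rV[F]_n) : 0 <= \sum_i v 0 i ^+ 2.
  by apply: sumr_ge0 => i _; apply: sqr_ge0.
have pAx : psdmx (A + x%:M).
  split=> [|v]; first by rewrite linearD /= pA.1 tr_scalar_mx.
  by rewrite q addr_ge0 ?pA.2 // mulr_ge0 // ltW.
split=> //; rewrite lt_neqAle psdmx_det_ge0 // andbT eq_sym.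
apply/det0P=> -[v nz v0]; have := q v; rewrite v0 mul0mx mxE => /esym/eqP.
rewrite paddr_eq0 ?pA.2 //; last by rewrite mulr_ge0 // ltW.
case/andP=> _; rewrite mulf_eq0 gt_eqF //= psumr_eq0 => [/allP z|i _].
  case/eqP: nz; apply/rowP=> i; rewrite mxE.
  by have := z i (mem_index_enum i); rewrite /= sqrf_eq0 => /eqP.
exact: sqr_ge0.
Qed.

(** Coercivity of [\tr (A B)] in [B]; [K] stands in for the inverse of the least eigenvalue of [A].
    With [C = L^T B L], each [D i * C i i] is at most [\tr (A B)], which bounds [\tr C]. Undoing the
    congruence, [\tr B = \tr (C G)] is bounded through the entries of [C]. *)
Lemma psdmx_tr_le n (A : 'M[F]_n) : A \in unitmx -> psdmx A ->
  exists K, forall B, psdmx B -> \tr B <= K * \tr (A *m B).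
Proof.
move=> uA /psdmx_ldl[L [D [eA tL L1 D0]]].
have uL : L \in unitmx by rewrite unitmxE det_unitrig // unitr1.
have Dp i : 0 < D 0 i.
  rewrite lt_neqAle D0 andbT eq_sym; apply/eqP=> z; move: uA.
  by rewrite unitmxE eA det_ldl // (bigD1 i) //= z mul0r unitr0.
pose G := invmx L *m (invmx L)^T.
exists ((\sum_i \sum_j `|G j i|) * \sum_i (D 0 i)^-1) => B pB.
have pC := psdmx_congr L^T pB; set C := _ *m _ *m _ in pC.
have eB : B = (invmx L)^T *m C *m invmx L.
  by rewrite /C trmxK !mulmxA trmx_inv mulVmx ?unitmx_tr // mul1mx mulmxK.
have tC : \tr C <= (\sum_i (D 0 i)^-1) * \tr (A *m B).
  rewrite mulr_suml; apply: ler_sum => i _.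
  rewrite -ler_pdivrMl ?invr_gt0 // invrK eA mxtrace_mul_ldl -/C (bigD1 i) //=.
  by rewrite lerDl sumr_ge0 // => j _; rewrite mulr_ge0 // psdmx_diag_ge0.
rewrite -mulrA; apply: le_trans (ler_wpM2l _ tC); last first.
  by do 2![apply: sumr_ge0 => ? _].
rewrite eB -mulmxA mxtrace_mulC -mulmxA -/G mulr_suml; apply: ler_sum => i _.
rewrite mulr_suml mxE; apply: ler_sum => j _.
apply: le_trans (ler_norm _) _; rewrite normrM mulrC.
by apply: ler_wpM2l => //; exact: psdmx_entry_le.
Qed.

End PosSemidef.

(** * Stdlib reals as a real field *)

Definition Rleb (x y : R) : bool := if Rle_dec x y then true else false.
Definition Rltb (x y : R) : bool := if Rlt_dec x y then true else false.

Local Open Scope R_scope.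
Delimit Scope ring_scope with ring.

Lemma RlebP x y : reflect (x <= y) (Rleb x y).
Proof. by rewrite /Rleb; case: Rle_dec => ?; constructor. Qed.

Lemma Rleb0D x y : Rleb 0 x -> Rleb 0 y -> Rleb 0 (x + y).
Proof. by move=> /RlebP ? /RlebP ?; apply/RlebP; lra. Qed.

Lemma Rleb0M x y : Rleb 0 x -> Rleb 0 y -> Rleb 0 (x * y).
Proof. by move=> /RlebP ? /RlebP ?; apply/RlebP; exact: Rmult_le_pos. Qed.

Lemma Rleb0_anti x : Rleb 0 x -> Rleb x 0 -> x = 0.
Proof. by move=> /RlebP ? /RlebP ?; lra. Qed.

Lemma Rleb_sub0 x y : Rleb 0 (y - x) = Rleb x y.
Proof. by apply/RlebP/RlebP => ?; lra. Qed.

Lemma Rleb0_total x : Rleb 0 x || Rleb x 0.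
Proof. by apply/orP; case: (Rle_dec 0 x) => ?; [left|right]; apply/RlebP; lra. Qed.

Lemma Rabs_id x : Rleb 0 x -> Rabs x = x.
Proof. by move=> /RlebP ?; exact: Rabs_pos_eq. Qed.

Lemma Rltb_def x y : Rltb x y = (y != x) && Rleb x y.
Proof.
rewrite /Rltb; case: Rlt_dec => xy; symmetry.
  by apply/andP; split; [apply/eqP; lra | apply/RlebP; lra].
by apply/negbTE/negP => /andP[/eqP ? /RlebP ?]; lra.
Qed.

(** With this instance, whose norm is [Rabs], [R] is a real field and the preceding section applies
    to [mat d]. *)
HB.instance Definition _ := Num.IntegralDomain_isLeReal.Build R
  Rleb0D Rleb0M Rleb0_anti Rleb_sub0 Rleb0_total Rabs_Ropp Rabs_id Rltb_def.

Lemma RleP (x y : R) : reflect (x <= y) (@Order.le ring_display R x y).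
Proof. exact: RlebP. Qed.

Lemma RltP (x y : R) : reflect (x < y) (@Order.lt ring_display R x y).
Proof. by rewrite -[X in reflect _ X]/(Rltb x y) /Rltb; case: Rlt_dec => ?; constructor. Qed.

Lemma RaddE (x y : R) : @Algebra.add R x y = x + y. Proof. by []. Qed.
Lemma RoppE (x : R) : @Algebra.opp R x = - x. Proof. by []. Qed.
Lemma RmulE (x y : R) : @GRing.mul R x y = x * y. Proof. by []. Qed.
Lemma RinvE (x : R) : @GRing.inv R x = / x. Proof. by []. Qed.
Lemma R0E : @Algebra.zero R = 0. Proof. by []. Qed.
Lemma R1E : @GRing.one R = 1. Proof. by []. Qed.
Lemma RexpE (x : R) n : @GRing.exp R x n = x ^ n.
Proof. by elim: n => [|n IH] //; rewrite exprS IH. Qed.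
Lemma RnatE n : @Algebra.natmul R (@GRing.one R) n = INR n.
Proof. by elim: n => [|n IH] //; rewrite mulrSr IH S_INR. Qed.

Definition RopE := (RaddE, RoppE, RmulE, RinvE, R0E, R1E, RexpE, RnatE).

Lemma psdP d (A : 'M[R]_d) : psd A <-> psdmx A.
Proof. by split=> -[sA pA]; split=> // v; apply/RleP; apply: pA. Qed.

(** * Bellman and Monge-Ampere operators *)

Lemma INR_gt0 d : (0 < d)%nat -> 0 < INR d.
Proof. by move=> /ssrnat.ltP; apply: lt_0_INR. Qed.

Lemma droot_ge0 d x : 0 <= droot d x.
Proof.
by rewrite /droot; case: Rlt_dec => h /=; [apply/Rlt_le/exp_pos|lra].
Qed.

Lemma droot_pow d x : (0 < d)%nat -> 0 <= x -> droot d x ^ d = x.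
Proof.
move=> d0 x0; rewrite /droot; case: Rlt_dec => h /=.
  rewrite -Rpower_pow; last exact: exp_pos.
  have := INR_gt0 d0 => dR.
  by rewrite Rpower_mult Rinv_l ?Rpower_1 //; lra.
have -> : 0 ^ d = 0 by apply/pow_i/ssrnat.ltP.
by lra.
Qed.

Lemma pow_le_reg n x y : (0 < n)%nat -> 0 <= x -> 0 <= y -> x ^ n <= y ^ n -> x <= y.
Proof.
move=> n0 /RleP x0 /RleP y0; rewrite -!RexpE => /RleP.
by rewrite ler_pXn2r // => /RleP.
Qed.

Lemma frobE d (A B : mat d) : Defs.symmetric A -> frob A B = (\tr (A *m B))%ring.
Proof. by rewrite /frob => ->. Qed.

Lemma psd_det_ge0 d (A : mat d) : psd A -> 0 <= determinant A.
Proof. by move=> /psdP/psdmx_det_ge0/RleP. Qed.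

Lemma psd_frob_ge0 d (A B : mat d) : psd A -> psd B -> 0 <= frob B A.
Proof.
move=> /psdP pA pB; rewrite (frobE _ pB.1); apply/RleP/psdmx_frob_ge0 => //.
exact/psdP.
Qed.

(** Both sides are nonnegative, so they may be compared after raising to the power [d], which
    removes the roots and leaves [psdmx_agm]. *)
Lemma frob_agm d (A B : mat d) : (0 < d)%nat -> psd A -> psd B ->
  INR d * (droot d (determinant A) * droot d (determinant B)) <= frob B A.
Proof.
move=> d0 pA pB; apply: (pow_le_reg d0).
- by apply: Rmult_le_pos; [exact: pos_INR|apply: Rmult_le_pos; exact: droot_ge0].
- exact: psd_frob_ge0.
rewrite !Rpow_mult_distr !droot_pow //; try exact: psd_det_ge0.
rewrite (frobE _ pB.1) mxtrace_mulC.
have /RleP := psdmx_agm ((psdP A).1 pA) ((psdP B).1 pB).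
by rewrite !RopE => H; apply: Rle_trans H; rewrite Rmult_comm; apply: Rle_refl.
Qed.

(** [frob_agm] against the identity even gives the bound [1 / d]; any bound suffices for the
    supremum to be finite. *)
Lemma droot_det_le1 d (B : mat d) : (0 < d)%nat -> S1 B ->
  droot d (determinant B) <= 1.
Proof.
move=> d0 [pB tB].
have p1 : psd (1%:M : mat d)%ring by apply/psdP/psdmx1.
have := frob_agm d0 p1 pB; rewrite (frobE _ pB.1) mulmx1 tB det1 R1E.
have -> : droot d 1 = 1.
  by rewrite /droot; case: Rlt_dec => [?|] /=; [rewrite /Rpower ln_1 Rmult_0_r exp_0|lra].
have : 1 <= INR d by rewrite -[1]/(INR 1); apply/le_INR/ssrnat.leP.
have := droot_ge0 d (determinant B); nra.
Qed.

(* [Hop] picks its value by [epsilon], junk unless the supremum exists. *)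
Lemma Hop_lub d (A : mat d) f : (0 < d)%nat -> 0 <= f -> is_lub (Hset A f) (Hop A f).
Proof.
move=> d0 f0; apply: epsilon_spec.
have [m mlub] : {m | is_lub (Hset A f) m}.
  apply: completeness.
    (* The entries of [B] are at most [\tr B = 1] in absolute value, so [K] bounds the trace term,
       while [f] bounds the determinant term. *)
    pose K := (\sum_i \sum_j `|A j i|)%ring.
    exists (K + f) => _ [B [sB ->]].
    have [pB tB] := sB.
    suff : - frob B A <= K.
      have := droot_det_le1 d0 sB; have := droot_ge0 d (determinant B); nra.
    rewrite (frobE _ pB.1) -RoppE; apply/RleP.
    apply: le_trans (ler_norm _) _; rewrite normrN /mxtrace.
    apply: le_trans (ler_norm_sum _ _ _) _; apply: ler_sum => i _.
    rewrite mxE; apply: le_trans (ler_norm_sum _ _ _) _; apply: ler_sum => j _.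
    rewrite normrM -[leRHS]mul1r; apply: ler_wpM2r => //.
    by rewrite -[1%ring]tB; apply: psdmx_entry_le; exact/psdP.
  pose i : 'I_d := Ordinal d0; pose B : mat d := delta_mx i i.
  exists (- frob B A + f * droot d (determinant B)), B; split => //; split.
    apply/psdP; have -> : B = (delta_mx i (0 : 'I_1) *m 1%:M *m (delta_mx i (0 : 'I_1))^T)%ring.
      by rewrite mulmx1 trmx_delta mul_delta_mx.
    exact/psdmx_congr/psdmx1.
  rewrite /mxtrace (bigD1 i) //= mxE !eqxx big1 ?addr0 // => j ji.
  by rewrite mxE (negbTE ji).
by exists m.
Qed.

Lemma Hop_le0_frob d (A B : mat d) f : (0 < d)%nat -> 0 <= f ->
  Hop A f <= 0 -> S1 B -> f * droot d (determinant B) <= frob B A.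
Proof.
move=> d0 f0 H0 sB; have [ub _] := Hop_lub A d0 f0.
by have := ub _ (ex_intro _ B (conj sB erefl)); lra.
Qed.

Lemma psd_scale d (A : mat d) c : 0 <= c -> psd A -> psd (c *: A)%ring.
Proof.
move=> c0 [sA pA]; split; first by rewrite /Defs.symmetric linearZ /= sA.
move=> v; rewrite /quad -scalemxAr -scalemxAl mxE.
exact/Rmult_le_pos/pA.
Qed.

Lemma Hop_le0_quad d (A : mat d) f : (0 < d)%nat -> 0 <= f ->
  Hop A f <= 0 -> forall v, 0 <= quad v A.
Proof.
move=> d0 f0 H0 v.
pose n := (v *m v^T)%ring ord0 ord0.
have pV : psd (v^T *m v)%ring.
  apply/psdP; have := psdmx_congr v^T (psdmx1 1).
  by rewrite mulmx1 trmxK.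
have n0 : 0 <= n.
  have := ((psdP 1%:M)%ring.2 (psdmx1 d)).2 v; by rewrite /quad mulmx1.
have tV : (\tr (v^T *m v))%ring = n by rewrite mxtrace_mulC /mxtrace big_ord1.
case: (Req_dec n 0) => [z|nz].
  have -> : v = 0%ring.
    apply/rowP=> i; rewrite mxE; apply/eqP.
    have : (\sum_i v ord0 i ^+ 2 == 0)%ring.
      apply/eqP; rewrite -[RHS]z /n mxE; apply: eq_bigr => j _.
      by rewrite mxE expr2.
    rewrite psumr_eq0 => [/allP h|j _]; last exact: sqr_ge0.
    by have := h i (mem_index_enum i); rewrite /= sqrf_eq0.
  by rewrite /quad mul0mx mul0mx mxE; apply: Rle_refl.
have sB : S1 (/ n *: (v^T *m v))%ring.
  split; first by apply: psd_scale => //; apply/Rlt_le/Rinv_0_lt_compat; lra.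
  by rewrite linearZ /= tV; apply: Rinv_l.
have := Hop_le0_frob d0 f0 H0 sB.
have -> : frob (/ n *: (v^T *m v))%ring A = / n * quad v A.
  rewrite (frobE _ sB.1.1) -scalemxAl linearZ /= -mulmxA mxtrace_mulC /mxtrace big_ord1.
  by [].
have := Rmult_le_pos _ _ f0 (droot_ge0 d (determinant (/ n *: (v^T *m v))%ring)).
have : 0 < / n by apply: Rinv_0_lt_compat; lra.
nra.
Qed.

Lemma continuity_pt_ext (g h : R -> R) x :
  (forall t, g t = h t) -> continuity_pt g x -> continuity_pt h x.
Proof. by move=> /functional_extensionality ->. Qed.

Lemma continuity_pt_sum (I : Type) (r : seq I) (F : I -> R -> R) x :
  (forall i, continuity_pt (F i) x) ->
  continuity_pt (fun t => (\sum_(i <- r) F i t)%ring) x.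
Proof.
move=> cF; elim: r => [|i r IH].
  apply: (@continuity_pt_ext (fun _ => 0)); first by move=> t; rewrite big_nil.
  exact: continuity_pt_const.
apply: (@continuity_pt_ext (fun t => F i t + (\sum_(j <- r) F j t)%ring)).
  by move=> t; rewrite big_cons.
exact: continuity_pt_plus.
Qed.

Lemma continuity_pt_prod (I : Type) (r : seq I) (F : I -> R -> R) x :
  (forall i, continuity_pt (F i) x) ->
  continuity_pt (fun t => (\prod_(i <- r) F i t)%ring) x.
Proof.
move=> cF; elim: r => [|i r IH].
  apply: (@continuity_pt_ext (fun _ => 1)); first by move=> t; rewrite big_nil.
  exact: continuity_pt_const.
apply: (@continuity_pt_ext (fun t => F i t * (\prod_(j <- r) F j t)%ring)).
  by move=> t; rewrite big_cons.
exact: continuity_pt_mult.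
Qed.

Lemma continuity_pt_det_add_scalar d (A : mat d) x :
  continuity_pt (fun t => (\det (A + t%:M))%ring) x.
Proof.
have cE (i j : 'I_d) : continuity_pt (fun t => (A + t%:M)%ring i j) x.
  apply: (@continuity_pt_ext (fun t => A i j + t * (if i == j then 1 else 0))).
    by move=> t; rewrite !mxE; case: eqP => _ /=; rewrite ?mulr1n ?mulr0n !RopE; lra.
  apply: continuity_pt_plus; first exact: continuity_pt_const.
  apply: continuity_pt_mult; last exact: continuity_pt_const.
  exact: (derivable_continuous_pt _ _ (derivable_pt_id x)).
rewrite /determinant; apply: continuity_pt_sum => s.
apply: continuity_pt_mult; first exact: continuity_pt_const.
by apply: continuity_pt_prod => i; apply: cE.
Qed.

Lemma det_gt0_unitmx d (A : mat d) : 0 < determinant A -> A \in unitmx.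
Proof. by move=> A0; rewrite unitmxE unitfE; apply/eqP; exact: Rgt_not_eq. Qed.

(** Only the test matrix is regularized: [Y] is the normalized inverse of [X = A + x I], yet it is
    paired with [A] itself. The shift contributes [- x] to [frob Y A], which has the favourable
    sign, so nothing has to be known about [Hop X f]. *)
Lemma det_ge_of_Hop_le0 d (A : mat d) f x : (0 < d)%nat -> 0 <= f -> 0 < x ->
  psd A -> Hop A f <= 0 -> (f / INR d) ^ d <= determinant (A + x%:M)%ring.
Proof.
move=> d0 f0 x0 pA H0.
pose X : mat d := (A + x%:M)%ring.
have [pX dX] : psd X /\ 0 < determinant X.
  have [|p q] := psdmx_add_scalar (x := x) _ ((psdP A).1 pA); first exact/RltP.
  by split; [exact/psdP|exact/RltP].
have uX : X \in unitmx by exact: det_gt0_unitmx.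
have pI := psdmx_invmx uX ((psdP X).1 pX).
pose tau : R := (\tr (invmx X))%ring.
have tau0 : 0 < tau by apply/RltP; apply: psdmx_tr_inv_gt0 => //; apply/psdP.
have it0 : 0 < / tau by exact: Rinv_0_lt_compat.
pose Y : mat d := (/ tau *: invmx X)%ring.
have sY : S1 Y.
  split; first by apply: psd_scale; [lra|exact/psdP].
  by rewrite /Y linearZ /=; apply: Rinv_l; lra.
have := Hop_le0_frob d0 f0 H0 sY.
have eF : frob Y A = INR d / tau - x.
  have -> : A = (X - x%:M)%ring by rewrite addrK.
  rewrite (frobE _ sY.1.1) mulmxBr linearB /= mul_mx_scalar linearZ /= sY.2.
  rewrite -scalemxAl mulVmx // linearZ /= mxtrace1 RnatE.
  by rewrite /Rminus /Rdiv (Rmult_comm (INR d)) -[x in - x]Rmult_1_r.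
rewrite eF => H1; have {H1} : f * droot d (determinant Y) <= INR d / tau by lra.
move=> /(fun h => pow_incr _ _ d (conj (Rmult_le_pos _ _ f0 (droot_ge0 _ _)) h)).
rewrite Rpow_mult_distr droot_pow //; last exact: psd_det_ge0 sY.1.
have -> : determinant Y = (/ tau) ^ d * / determinant X.
  by rewrite detZ det_inv !RopE.
have dR := INR_gt0 d0.
rewrite /Rdiv !Rpow_mult_distr pow_inv => H.
have t1 : 0 < tau ^ d by exact: pow_lt.
have dd : 0 < INR d ^ d by exact: pow_lt.
have H2 : f ^ d <= INR d ^ d * determinant X.
  have := Rmult_le_compat_r (tau ^ d * determinant X) _ _ _ H.
  have -> : f ^ d * (/ tau ^ d * / determinant X) * (tau ^ d * determinant X) = f ^ d.
    by field; lra.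
  have -> : INR d ^ d * / tau ^ d * (tau ^ d * determinant X) = INR d ^ d * determinant X.
    by field; lra.
  by apply; apply: Rmult_le_pos; lra.
have := Rmult_le_compat_r (/ INR d ^ d) _ _ (Rlt_le _ _ (Rinv_0_lt_compat _ dd)) H2.
have -> : INR d ^ d * determinant X * / INR d ^ d = determinant X by field; lra.
by rewrite pow_inv.
Qed.

Lemma Mop_le0 d (A : mat d) f : (0 < d)%nat -> 0 <= f ->
  Defs.symmetric A -> Hop A f <= 0 -> Mop A f <= 0.
Proof.
move=> d0 f0 sA H0.
have pA : psd A by split => //; exact: Hop_le0_quad H0.
rewrite /Mop; apply: Rle_minus; apply: Rnot_lt_le => lt.
have := continuity_pt_det_add_scalar A 0.
case/(_ ((f / INR d) ^ d - determinant A)); first lra.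
move=> e [e0 he].
(* [continuity_pt] concerns points other than 0, and [det_ge_of_Hop_le0] needs a positive shift. *)
have /he : D_x no_cond 0 (e / 2) /\ Rdist (e / 2) 0 < e.
  rewrite /Rdist Rminus_0_r Rabs_pos_eq; last lra.
  by split; [split=> //; lra | lra].
rewrite /dist /= /Rdist.
have -> : (A + 0%:M = A)%ring by rewrite (_ : (0%:M = 0)%ring) ?addr0 //; apply: raddf0.
move=> /Rabs_def2[h _].
by have := @det_ge_of_Hop_le0 d A f (e / 2) d0 f0 _ pA H0; lra.
Qed.

Lemma Mop_ge0 d (A : mat d) f : (0 < d)%nat -> 0 <= f ->
  psd A -> 0 <= Hop A f -> 0 <= Mop A f.
Proof.
move=> d0 f0 pA H0; rewrite /Mop; apply: Rge_le; apply: Rge_minus; apply: Rle_ge.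
apply: Rnot_lt_le => lt.
have dR := INR_gt0 d0.
have fd0 : 0 <= f / INR d by apply: Rmult_le_pos => //; apply/Rlt_le/Rinv_0_lt_compat.
have dA : 0 < determinant A by have := pow_le _ d fd0; lra.
have uA : A \in unitmx by exact: det_gt0_unitmx.
pose a := droot d (determinant A).
have a0 : 0 <= a := droot_ge0 _ _.
have fa : f / INR d < a.
  apply: Rnot_le_lt => h; have := pow_incr _ _ d (conj a0 h).
  by rewrite /a droot_pow //; lra.
have [K HK] := psdmx_tr_le uA ((psdP A).1 pA).
have KB B : S1 B -> 1 <= K * frob B A.
  move=> [pB tB]; have /RleP := HK B ((psdP B).1 pB).
  by rewrite tB (frobE _ pB.1) mxtrace_mulC.
have agm B : S1 B -> INR d * (a * droot d (determinant B)) <= frob B A.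
  by move=> sB; exact: frob_agm sB.1.
have [_ lub] := Hop_lub A d0 f0.
have ap : 0 < a by lra.
(* Multiplying [agm] by [f / (d a)], which is below 1, absorbs the determinant term into that
   fraction of [frob B A]; [c] is the fraction that remains. *)
pose c := 1 - f / INR d / a.
have c0 : 0 < c.
  rewrite /c; suff : f / INR d / a < 1 by lra.
  by apply: (Rmult_lt_reg_r a) => //; rewrite Rmult_1_l /Rdiv Rmult_assoc Rinv_l ?Rmult_1_r //; lra.
have F B : S1 B -> - frob B A + f * droot d (determinant B) <= - c * frob B A.
  move=> sB; have := agm B sB => h.
  have q : 0 <= f / INR d / a by apply: Rmult_le_pos => //; apply/Rlt_le/Rinv_0_lt_compat.
  have := Rmult_le_compat_l _ _ _ q h.
  have -> : f / INR d / a * (INR d * (a * droot d (determinant B))) = f * droot d (determinant B).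
    by field; lra.
  rewrite /c; lra.
have K0 : 0 < K \/ K <= 0 by lra.
have G B : S1 B -> 0 < K /\ / K <= frob B A.
  move=> sB; have k := KB B sB; have g := psd_frob_ge0 pA sB.1.
  have Kp : 0 < K by case: K0 => // ?; nra.
  split => //; apply: (Rmult_le_reg_l K) => //; rewrite Rinv_r; lra.
(* For [K <= 0] the bound [KB] leaves no matrix in [S1], so [Hset] is empty and -1 is an upper
   bound. *)
case: K0 => Kp; last first.
  suff : Hop A f <= -1 by lra.
  by apply: lub => r [B [/G[? ?] _]]; lra.
have iK : 0 < / K by exact: Rinv_0_lt_compat.
suff : Hop A f <= - c * / K by nra.
apply: lub => r [B [sB ->]].
by have := F B sB; have := (G B sB).2; nra.
Qed.

(** * Calculus along lines *)

Lemma shift_coord d (x : pt d) t i k :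
  shift x t i ord0 k = x ord0 k + (if k == i then t else 0).
Proof.
by rewrite !mxE !RopE eqxx /=; case: eqP => _ /=; lra.
Qed.

Lemma line_coord d (x v : pt d) t k :
  (x + t *: v)%ring ord0 k = x ord0 k + t * v ord0 k.
Proof. by rewrite !mxE. Qed.

Lemma lincomb_coord d t (x : pt d) s (y : pt d) k :
  lincomb t x s y ord0 k = t * x ord0 k + s * y ord0 k.
Proof. by rewrite !mxE. Qed.

Lemma pt_ext d (x y : pt d) : (forall k, x ord0 k = y ord0 k :> R) -> x = y.
Proof. by move=> xy; apply/rowP => k; exact: xy. Qed.

Lemma shift0 d (x : pt d) i : shift x 0 i = x.
Proof. by rewrite /shift scale0r addr0. Qed.

Lemma shift_shift d (x : pt d) s t i : shift (shift x s i) t i = shift x (s + t) i.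
Proof. by rewrite /shift -addrA -scalerDl. Qed.

Lemma shiftC d (x : pt d) s t i j : shift (shift x s i) t j = shift (shift x t j) s i.
Proof. by rewrite /shift addrAC. Qed.

(** Half the radius is allotted to each shift because for [i = j] the two displacements add up. *)
Lemma near_shift d (x : pt d) r s t i j : Rabs s < r / 2 -> Rabs t < r / 2 ->
  near x (shift (shift x s i) t j) r.
Proof.
move=> hs ht k; rewrite !shift_coord; do 2 case: ifP => _;
  split_Rabs; lra.
Qed.

Lemma abs_coord_le d (v : pt d) k : Rabs (v ord0 k) <= (\sum_i `|v ord0 i|)%ring.
Proof.
apply/RleP; rewrite (bigD1 k) //= lerDl; exact: sumr_ge0.
Qed.

Lemma near_line d (x v : pt d) r : 0 < r -> exists e, 0 < e /\
  forall t, Rabs t < e -> near x (x + t *: v)%ring r.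
Proof.
move=> r0; pose M : R := (\sum_i `|v ord0 i|)%ring.
have M0 : 0 <= M by apply/RleP; apply: sumr_ge0.
exists (r / (M + 1)); split; first by apply: Rdiv_lt_0_compat; lra.
move=> t ht k; rewrite line_coord.
have -> : x ord0 k + t * v ord0 k - x ord0 k = t * v ord0 k by lra.
rewrite Rabs_mult; apply: (Rle_lt_trans _ (Rabs t * M)).
  by apply: Rmult_le_compat_l; [exact: Rabs_pos|exact: abs_coord_le].
have h := Rmult_lt_compat_r (M + 1) _ _ _ ht.
have : r / (M + 1) * (M + 1) = r by field; lra.
have := Rabs_pos t; have := h _; nra.
Qed.

Lemma derivable_pt_lim_translate h t l :
  derivable_pt_lim (fun s => h (t + s)) 0 l -> derivable_pt_lim h t l.
Proof.
move=> H e e0; have [del Hd] := H e e0; exists del => s s0 hs.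
by have := Hd s s0 hs; rewrite Rplus_0_l Rplus_0_r.
Qed.

(** [Om] is an arbitrary predicate, not assumed open; [hessian_sym] uses it on a smaller set where a
    difference of two translates is differentiable. *)
Lemma mvt_coord d (Om : pt d -> Prop) g Dg i x a :
  (forall y, Om y -> pderiv g i y (Dg y)) ->
  (forall t, Rabs t <= Rabs a -> Om (shift x t i)) ->
  exists s, Rabs s <= Rabs a /\ g (shift x a i) - g x = a * Dg (shift x s i).
Proof.
move=> pd HO.
have D t : Rabs t <= Rabs a ->
    derivable_pt_lim (fun s => g (shift x s i)) t (Dg (shift x t i)).
  move=> /HO /pd H; apply: derivable_pt_lim_translate.
  by apply: derivable_pt_lim_ext H => s; rewrite shift_shift.
case: (Rtotal_order a 0) => [a0|[->|a0]].
- have [|c [e hc]] := @MVT_cor2 (fun s => g (shift x s i)) (fun s => Dg (shift x s i)) a 0 a0.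
    by move=> c hc; apply: D; split_Rabs; lra.
  exists c; split; first by split_Rabs; lra.
  by move: e; rewrite shift0 => e; lra.
- by exists 0; split; [apply: Rle_refl|rewrite shift0; lra].
- have [|c [e hc]] := @MVT_cor2 (fun s => g (shift x s i)) (fun s => Dg (shift x s i)) 0 a a0.
    by move=> c hc; apply: D; split_Rabs; lra.
  exists c; split; first by split_Rabs; lra.
  by move: e; rewrite shift0 => e; lra.
Qed.

(** If [L < 0], then [h1] is below [h1 0] just right of 0 and above it just left. The mean value
    theorem on both sides then gives [h t + h (- t) < 2 * h 0]. *)
Lemma midconvex_deriv2_ge0 h h1 L r : 0 < r ->
  (forall t, Rabs t < r -> derivable_pt_lim h t (h1 t)) ->
  derivable_pt_lim h1 0 L ->
  (forall t, Rabs t < r -> 2 * h 0 <= h t + h (- t)) -> 0 <= L.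
Proof.
move=> r0 Dh Dh1 cvx; apply: Rnot_lt_le => L0.
have [|[del del0] /= Hd] := Dh1 (- L); first lra.
pose t := Rmin r del / 2.
have m0 : 0 < Rmin r del by exact: Rmin_glb_lt.
have tr : t < r by have := Rmin_l r del; rewrite /t; lra.
have td : t < del by have := Rmin_r r del; rewrite /t; lra.
have t0 : 0 < t by rewrite /t; lra.
have [|c [e hc]] := @MVT_cor2 h h1 0 t t0.
  by move=> c hc; apply: Dh; split_Rabs; lra.
have [|c' [e' hc']] := @MVT_cor2 h h1 (- t) 0 ltac:(lra).
  by move=> c' hc'; apply: Dh; split_Rabs; lra.
have Q s : s <> 0 -> Rabs s < del -> (h1 s - h1 0) / s < 0.
  by move=> s0 hs; have := Hd s s0 hs; rewrite Rplus_0_l; split_Rabs; lra.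
have q1 : h1 c < h1 0.
  have /Q h' : c <> 0 by lra.
  have {}h' := h' ltac:(split_Rabs; lra).
  have : (h1 c - h1 0) / c * c = h1 c - h1 0 by field; lra.
  nra.
have q2 : h1 0 < h1 c'.
  have /Q h' : c' <> 0 by lra.
  have {}h' := h' ltac:(split_Rabs; lra).
  have : (h1 c' - h1 0) / c' * c' = h1 c' - h1 0 by field; lra.
  nra.
have := cvx t ltac:(split_Rabs; lra); nra.
Qed.

Section Calculus.
Context {d : nat} {Om : pt d -> Prop}.
Hypothesis Hopen : is_open Om.

(* The increment along [v] is split into increments along the coordinate axes, to
   each of which the mean value theorem applies. *)
Lemma derivable_pt_lim_line g Dg x (v : pt d) :
  (forall i y, Om y -> pderiv g i y (Dg i y)) -> (forall i, cont_on Om (Dg i)) ->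
  Om x ->
  derivable_pt_lim (fun t => g (x + t *: v)%ring) 0 (\sum_i v ord0 i * Dg i x)%ring.
Proof.
move=> pd ct Ox; have [r [r0 Hr]] := Hopen Ox.
pose w s : pt d := (\sum_(i <- s) v ord0 i *: delta_mx ord0 i)%ring.
suff S (s : seq 'I_d) : derivable_pt_lim (fun t => g (x + t *: w s)%ring) 0
    (\sum_(i <- s) v ord0 i * Dg i x)%ring.
  by have := S (index_enum 'I_d); rewrite /w -row_sum_delta.
elim: s => [|i s IH].
  rewrite big_nil; apply: (@derivable_pt_lim_ext (fun _ => g x)).
    by move=> t; rewrite /w big_nil scaler0 addr0.
  exact: derivable_pt_lim_const.
rewrite big_cons; set a := v ord0 i.
have eq (t : R) : (x + t *: w (i :: s))%ring = shift (x + t *: w s)%ring (t * a) i.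
  by rewrite /w big_cons /shift scalerDr scalerA -addrA; congr (_ + _)%ring; exact: addrC.
pose q (t : R) := g (shift (x + t *: w s)%ring (t * a) i) - g (x + t *: w s)%ring.
have Dq : derivable_pt_lim q 0 (a * Dg i x).
  move=> e e0.
  have ea : 0 < e / (Rabs a + 1).
    by apply: Rdiv_lt_0_compat => //; have := Rabs_pos a; lra.
  have [del [del0 Hdel]] := ct i x Ox _ ea.
  pose rho := Rmin r del; have rho0 : 0 < rho by exact: Rmin_glb_lt.
  have rho2 : 0 < rho / 2 by lra.
  have [e1 [e10 He1]] := near_line x (w s) rho2.
  have e2 : 0 < rho / 2 / (Rabs a + 1).
    by apply: Rdiv_lt_0_compat => //; have := Rabs_pos a; lra.
  have m0 : 0 < Rmin e1 (rho / 2 / (Rabs a + 1)) by exact: Rmin_glb_lt.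
  exists (mkposreal _ m0) => h h0 /= hh.
  have hh1 := Rlt_le_trans _ _ _ hh (Rmin_l _ _).
  have hh2 := Rlt_le_trans _ _ _ hh (Rmin_r _ _).
  have ha : Rabs (h * a) < rho / 2.
    have := Rmult_lt_compat_r (Rabs a + 1) _ _ _ hh2.
    have -> : rho / 2 / (Rabs a + 1) * (Rabs a + 1) = rho / 2.
      by field; have := Rabs_pos a; lra.
    rewrite Rabs_mult; have := Rabs_pos a; have := Rabs_pos h => ? ? H.
    by have := H ltac:(lra); lra.
  have nr c : Rabs c <= Rabs (h * a) -> near x (shift (x + h *: w s)%ring c i) rho.
    move=> hc k; have := He1 h hh1 k; rewrite shift_coord.
    by case: ifP => _; split_Rabs; lra.
  have [c [hc ec]] := @mvt_coord d Om g (Dg i) i (x + h *: w s)%ring (h * a) (pd i)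
    (fun c hc => Hr _ (fun k => Rlt_le_trans _ _ _ (nr c hc k) (Rmin_l _ _))).
  rewrite Rplus_0_l /q ec.
  have -> : g (shift (x + 0 *: w s)%ring (0 * a) i) - g (x + 0 *: w s)%ring = 0.
    by rewrite Rmult_0_l shift0; lra.
  set D1 := Dg i _.
  have -> : (h * a * D1 - 0) / h - a * Dg i x = a * (D1 - Dg i x) by field.
  have D1e : Rabs (D1 - Dg i x) < e / (Rabs a + 1).
    apply: Hdel => [|k]; last exact: Rlt_le_trans (nr c hc k) (Rmin_r _ _).
    by apply: Hr => k; exact: Rlt_le_trans (nr c hc k) (Rmin_l _ _).
  rewrite Rabs_mult; have := Rmult_lt_compat_r (Rabs a + 1) _ _ _ D1e.
  have -> : e / (Rabs a + 1) * (Rabs a + 1) = e by field; have := Rabs_pos a; lra.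
  have := Rabs_pos a; have := Rabs_pos (D1 - Dg i x) => ? ? H.
  by have := H ltac:(lra); lra.
apply: derivable_pt_lim_ext (derivable_pt_lim_plus _ _ _ _ _ Dq IH) => t.
by rewrite eq /plus_fct /q; lra.
Qed.

(** [C2_on] does not identify the mixed derivatives, so Schwarz's theorem is proved here. The second
    difference [Del] is symmetric in the two directions, and two uses of the mean value theorem
    write it as the squared step times a mixed derivative at a nearby point. *)
Lemma hessian_sym phi Dphi D2phi x : C2_on Om phi Dphi D2phi -> Om x ->
  Defs.symmetric (hessian D2phi x).
Proof.
case=> _ [_ [ct2 [pd1 pd2]]] Ox.
pose Del t i j := phi (shift (shift x t i) t j) - phi (shift x t i)
  - (phi (shift x t j) - phi x).
have key i j r : 0 < r -> (forall y, near x y r -> Om y) ->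
    exists y, near x y r /\ Del (r / 4) i j = r / 4 * (r / 4 * D2phi i j y).
  move=> r0 Hr; set t := r / 4; have ta : Rabs t = t by rewrite Rabs_pos_eq /t; lra.
  (* The first mean value theorem is applied to [phi (shift y t j) - phi y], differentiable where
     both points lie in [Om]. *)
  pose Om' y := Om y /\ Om (shift y t j).
  have N c c' i' j' : Rabs c <= Rabs t -> Rabs c' <= Rabs t ->
      near x (shift (shift x c i') c' j') r.
    by move=> h h'; apply: near_shift; move: h h'; rewrite ta /t; lra.
  have N1 c i' : Rabs c <= Rabs t -> near x (shift x c i') r.
    by move=> h; rewrite -(shift0 (shift x c i') i'); apply: N => //;
      rewrite Rabs_R0; exact: Rabs_pos.
  have [|c hc|c [hc e]] := @mvt_coord d Om' (fun y => phi (shift y t j) - phi y)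
      (fun y => Dphi i (shift y t j) - Dphi i y) i x t.
  - move=> y [Oy Oyt]; apply: derivable_pt_lim_minus; last exact: pd1.
    by apply: derivable_pt_lim_ext (pd1 i _ Oyt) => s; rewrite shiftC.
  - by split; apply: Hr; [exact: N1|apply: N => //; exact: Rle_refl].
  have [|c' hc'|c' [hc' e']] := @mvt_coord d Om (Dphi i) (D2phi i j) j (shift x c i) t.
  - by move=> y Oy; exact: pd2.
  - by apply: Hr; exact: N.
  exists (shift (shift x c i) c' j); split; first exact: N.
  by rewrite /Del e e'.
apply/matrixP => i j; rewrite !mxE; apply: cond_eq => e e0.
have e2 : 0 < e / 2 by lra.
have [d1 [d10 H1]] := ct2 i j x Ox _ e2.
have [d2 [d20 H2]] := ct2 j i x Ox _ e2.
have [r [r0 Hr]] := Hopen Ox.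
pose rho := Rmin r (Rmin d1 d2).
have rho0 : 0 < rho by do 2 apply: Rmin_glb_lt => //.
have l1 : rho <= r by exact: Rmin_l.
have l2 : rho <= d1 by exact: Rle_trans (Rmin_r _ _) (Rmin_l _ _).
have l3 : rho <= d2 by exact: Rle_trans (Rmin_r _ _) (Rmin_r _ _).
have mono y s : rho <= s -> near x y rho -> near x y s.
  by move=> l n k; exact: Rlt_le_trans (n k) l.
have sub y : near x y rho -> Om y by move=> /(mono _ _ l1); exact: Hr.
have [y [ny ey]] := key i j rho rho0 sub.
have [z [nz ez]] := key j i rho rho0 sub.
have yz : D2phi i j y = D2phi j i z.
  apply: (Rmult_eq_reg_l (rho / 4)); last lra.
  apply: (Rmult_eq_reg_l (rho / 4)); last lra.
  by rewrite -ey -ez /Del shiftC; lra.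
have := H1 y (sub _ ny) (mono _ _ l2 ny); have := H2 z (sub _ nz) (mono _ _ l3 nz).
by rewrite yz; split_Rabs; lra.
Qed.

(** The quadratic form at [v] is the second derivative of [phi] along the line in direction [v], and
    convexity at the midpoint of [x + t v] and [x - t v] makes it nonnegative. *)
Lemma convex_hessian_psd phi Dphi D2phi x : C2_on Om phi Dphi D2phi ->
  convex_on Om phi -> Om x -> psd (hessian D2phi x).
Proof.
move=> C2 cvx Ox; split; first exact: hessian_sym C2 Ox.
case: C2 => _ [ct1 [ct2 [pd1 pd2]]] v.
have [r [r0 Hr]] := Hopen Ox; have [e [e0 He]] := near_line x v r0.
apply: (@midconvex_deriv2_ge0 (fun t => phi (x + t *: v)%ring)
  (fun t => (\sum_i v ord0 i * Dphi i (x + t *: v))%ring) _ e e0).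
- move=> t ht; apply: derivable_pt_lim_translate.
  apply: derivable_pt_lim_ext (derivable_pt_lim_line v pd1 ct1 (Hr _ (He t ht))) => s.
  by rewrite -addrA -scalerDl.
- have S (s : seq 'I_d) : derivable_pt_lim
      (fun t => (\sum_(i <- s) v ord0 i * Dphi i (x + t *: v))%ring) 0
      (\sum_(i <- s) v ord0 i * \sum_j v ord0 j * D2phi i j x)%ring.
    elim: s => [|i s IH].
      rewrite big_nil; apply: (@derivable_pt_lim_ext (fun _ => 0)).
        by move=> t; rewrite big_nil.
      exact: derivable_pt_lim_const.
    rewrite big_cons.
    apply: (@derivable_pt_lim_ext (fun t => v ord0 i * Dphi i (x + t *: v)%ring +
      (\sum_(j <- s) v ord0 j * Dphi j (x + t *: v))%ring)).
      by move=> t; rewrite big_cons.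
    apply: derivable_pt_lim_plus IH; apply: derivable_pt_lim_scal.
    exact: (derivable_pt_lim_line v (pd2 i) (ct2 i) Ox).
  have -> : quad v (hessian D2phi x) =
      (\sum_i v ord0 i * \sum_j v ord0 j * D2phi i j x)%ring.
    rewrite /quad -mulmxA mxE; apply: eq_bigr => i _; rewrite mxE; congr Rmult.
    by apply: eq_bigr => j _; rewrite !mxE; exact: Rmult_comm.
  exact: S.
- move=> t ht; rewrite scale0r addr0.
  have p1 := Hr _ (He t ht).
  have p2 := Hr _ (He (- t) ltac:(by rewrite Rabs_Ropp)).
  have := cvx _ _ p1 p2 (1 / 2) ltac:(lra).
  have -> : lincomb (1 / 2) (x + t *: v)%ring (1 - 1 / 2) (x + - t *: v)%ring = x.
    by apply: pt_ext => k; rewrite lincomb_coord !line_coord RoppE; lra.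
  lra.
Qed.

End Calculus.

(** * Semicontinuous functions and convexity *)

(** Bolzano-Weierstrass for a chain of nonempty sets instead of a sequence. The coordinates of [c]
    are fixed one at a time, each as a lower limit over the points whose earlier coordinates are
    already close to [c]. *)
Lemma cluster_point d (I : Type) (A : I -> pt d -> Prop) (i0 : I) M :
  (forall i j, (forall p, A i p -> A j p) \/ (forall p, A j p -> A i p)) ->
  (forall i, exists p, A i p) ->
  (forall i p, A i p -> forall k, Rabs (p ord0 k) <= M) ->
  exists c, forall i e, 0 < e -> exists p, A i p /\ near c p e.
Proof.
move=> nest ne bd.
suff S n : exists c : pt d, forall i e, 0 < e -> exists p, A i p /\
    forall k : 'I_d, (k < n)%nat -> Rabs (p ord0 k - c ord0 k) < e.
  have [c Hc] := S d; exists c => i e e0; have [p [Ap Hp]] := Hc i e e0.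
  by exists p; split => // k; exact: Hp.
elim: n => [|n [c IH]].
  by exists 0%ring => i e _; have [p Ap] := ne i; exists p.
case: (ltnP n d) => nd; last first.
  exists c => i e e0; have [p [Ap Hp]] := IH i e e0; exists p; split=> // k _.
  by apply: Hp; exact: leq_trans (ltn_ord k) nd.
pose k0 := Ordinal nd.
pose E t := exists i e, 0 < e /\ forall p, A i p ->
  (forall k : 'I_d, (k < n)%nat -> Rabs (p ord0 k - c ord0 k) < e) -> t <= p ord0 k0.
have [s [ub lub]] : {s | is_lub E s}.
  apply: completeness.
    exists M => t [i [e [e0 H]]]; have [p [Ap Hp]] := IH i e e0.
    by have := H p Ap Hp; have := bd i p Ap k0; split_Rabs; lra.
  exists (- M), i0, 1; split; first lra.
  by move=> p Ap _; have := bd i0 p Ap k0; split_Rabs; lra.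
exists (\row_k if k == k0 then s else c ord0 k)%ring => i e e0.
(* A member of [E] close to [s] bounds the new coordinate from below; that [s + e / 2] is not in [E]
   yields a point bounded from above. The smaller of the two sets serves both. *)
have [t [[i1 [e1 [e10 H1]]] ts]] : exists t, E t /\ s - e / 2 < t.
  apply: NNPP => no; suff : s <= s - e / 2 by lra.
  by apply: lub => t Et; apply: Rnot_lt_le => lt; apply: no; exists t.
have [j [ji ji1]] : exists j, (forall p, A j p -> A i p) /\ (forall p, A j p -> A i1 p).
  by case: (nest i i1) => h; [exists i|exists i1].
have m0 : 0 < Rmin e e1 by exact: Rmin_glb_lt.
have [p [Ap [Hp ps]]] : exists p, A j p /\
    (forall k : 'I_d, (k < n)%nat -> Rabs (p ord0 k - c ord0 k) < Rmin e e1) /\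
    p ord0 k0 < s + e / 2.
  apply: NNPP => no; have : s + e / 2 <= s; last lra.
  apply: ub; exists j, (Rmin e e1); split=> // p Ap Hp; apply: Rnot_lt_le => lt.
  by apply: no; exists p.
exists p; split; first exact: ji.
move=> k kn; rewrite mxE; case: eqP => [->|/eqP kk].
  have := H1 p (ji1 _ Ap) (fun k h => Rlt_le_trans _ _ _ (Hp k h) (Rmin_r _ _)).
  by split_Rabs; lra.
apply: Rlt_le_trans (Hp k _) (Rmin_l _ _).
by move: kn; rewrite ltnS leq_eqVlt => /orP[/eqP e'|//]; case/eqP: kk; apply: val_inj.
Qed.

(** The chain consists of the superlevel sets of [g] in [K], indexed by the points of [K]. At a
    cluster point [c], a value below some [g q] would by semicontinuity exclude nearby points of the
    superlevel set of [q]. *)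
Lemma usc_attains_max d (Om K : pt d -> Prop) g : usc_on Om g ->
  (forall p, K p -> Om p) -> is_bounded K -> (exists p, K p) ->
  (forall c, Defs.closure K c -> K c) ->
  exists c, K c /\ forall p, K p -> g p <= g c.
Proof.
move=> usc sub [M bd] [p0 Kp0] cl.
have [|q|q p [] /bd //|c Hc] := @cluster_point d {q | K q}
    (fun q p => K p /\ g (sval q) <= g p) (exist _ p0 Kp0) M.
- move=> [q1 /= _] [q2 /= _]; case: (Rle_dec (g q1) (g q2)) => h; [right|left];
  by move=> p [Kp hp]; split => //; lra.
- by exists (sval q); split; [exact: (svalP q)|exact: Rle_refl].
have Kc : K c.
  apply: cl => e e0; have [p [[Kp _] np]] := Hc (exist _ p0 Kp0) e e0.
  by exists p.
exists c; split => // q Kq; apply: Rnot_lt_le => lt.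
have [|del [del0 Hd]] := usc c (sub _ Kc) (g q - g c); first lra.
have [p [[Kp gp] np]] := Hc (exist _ q Kq) del del0.
by have := Hd p (sub _ Kp) np; move: gp => /=; lra.
Qed.

Section Continuity.
Context {d : nat} {Om : pt d -> Prop}.

Lemma cont_on_ext (g h : pt d -> R) :
  (forall p, g p = h p) -> cont_on Om g -> cont_on Om h.
Proof. by move=> /functional_extensionality ->. Qed.

Lemma cont_on_const a : cont_on Om (fun _ => a).
Proof.
by move=> x _ e e0; exists 1; split=> [|y _ _]; [lra|rewrite Rminus_diag Rabs_R0].
Qed.

Lemma cont_on_coord k : cont_on Om (fun p => p ord0 k).
Proof. by move=> x _ e e0; exists e; split=> // y _; apply. Qed.

Lemma cont_on_plus g h : cont_on Om g -> cont_on Om h -> cont_on Om (fun p => g p + h p).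
Proof.
move=> cg ch x Ox e e0; have e2 : 0 < e / 2 by lra.
have [d1 [d10 H1]] := cg x Ox _ e2; have [d2 [d20 H2]] := ch x Ox _ e2.
exists (Rmin d1 d2); split; first exact: Rmin_glb_lt.
move=> y Oy n.
have := H1 y Oy (fun k => Rlt_le_trans _ _ _ (n k) (Rmin_l _ _)).
have := H2 y Oy (fun k => Rlt_le_trans _ _ _ (n k) (Rmin_r _ _)).
by split_Rabs; lra.
Qed.

Lemma cont_on_mult g h : cont_on Om g -> cont_on Om h -> cont_on Om (fun p => g p * h p).
Proof.
move=> cg ch x Ox e e0.
pose D := Rabs (g x) + Rabs (h x) + 1.
have D0 : 0 < D by have := Rabs_pos (g x); have := Rabs_pos (h x); rewrite /D; lra.
pose eta := Rmin 1 (e / D).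
have eta0 : 0 < eta by apply: Rmin_glb_lt; [lra|exact: Rdiv_lt_0_compat].
have eta1 : eta <= 1 by exact: Rmin_l.
have etae : eta * D <= e.
  have := Rmult_le_compat_r _ _ _ (Rlt_le _ _ D0) (Rmin_r 1 (e / D)).
  by rewrite -/eta; have -> : e / D * D = e by field; lra.
have [d1 [d10 H1]] := cg x Ox _ eta0; have [d2 [d20 H2]] := ch x Ox _ eta0.
exists (Rmin d1 d2); split; first exact: Rmin_glb_lt.
move=> y Oy n.
have h1 := H1 y Oy (fun k => Rlt_le_trans _ _ _ (n k) (Rmin_l _ _)).
have h2 := H2 y Oy (fun k => Rlt_le_trans _ _ _ (n k) (Rmin_r _ _)).
have -> : g y * h y - g x * h x =
    (g y - g x) * (h y - h x) + ((g y - g x) * h x + g x * (h y - h x)) by ring.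
apply: Rle_lt_trans (Rabs_triang _ _) _.
apply: Rle_lt_trans (Rplus_le_compat_l _ _ _ (Rabs_triang _ _)) _.
rewrite !Rabs_mult; have := Rabs_pos (g x); have := Rabs_pos (h x).
have := Rabs_pos (g y - g x); have := Rabs_pos (h y - h x).
by move: etae; rewrite /D; nra.
Qed.

Lemma cont_on_sum (I : Type) (r : seq I) (F : I -> pt d -> R) :
  (forall i, cont_on Om (F i)) -> cont_on Om (fun p => (\sum_(i <- r) F i p)%ring).
Proof.
move=> cF; elim: r => [|i r IH].
  apply: (@cont_on_ext (fun _ => 0)); first by move=> p; rewrite big_nil.
  exact: cont_on_const.
apply: (@cont_on_ext (fun p => F i p + (\sum_(j <- r) F j p)%ring)).
  by move=> p; rewrite big_cons.
exact: cont_on_plus.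
Qed.

Lemma cont_on_affine (x : pt d) (A : mat d) j :
  cont_on Om (fun p => ((p - x) *m A)%ring ord0 j).
Proof.
apply: (@cont_on_ext (fun p => (\sum_i (p ord0 i + - x ord0 i)%R * A i j)%ring)).
  by move=> p; rewrite !mxE; apply: eq_bigr => i _; rewrite !mxE.
apply: cont_on_sum => i; apply: cont_on_mult; last exact: cont_on_const.
by apply: cont_on_plus; [exact: cont_on_coord|exact: cont_on_const].
Qed.

Lemma cont_on_quad (x : pt d) (A : mat d) : cont_on Om (fun p => quad (p - x)%ring A).
Proof.
apply: (@cont_on_ext (fun p => (\sum_j ((p - x) *m A)%ring ord0 j *
    (p ord0 j + - x ord0 j)%R)%ring)).
  by move=> p; rewrite /quad [RHS]mxE; apply: eq_bigr => j _; rewrite !mxE.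
apply: cont_on_sum => j; apply: cont_on_mult; first exact: cont_on_affine.
by apply: cont_on_plus; [exact: cont_on_coord|exact: cont_on_const].
Qed.

Lemma usc_on_minus g h : usc_on Om g -> cont_on Om h -> usc_on Om (fun p => g p - h p).
Proof.
move=> ug ch x Ox e e0; have e2 : 0 < e / 2 by lra.
have [d1 [d10 H1]] := ug x Ox _ e2; have [d2 [d20 H2]] := ch x Ox _ e2.
exists (Rmin d1 d2); split; first exact: Rmin_glb_lt.
move=> y Oy n.
have := H1 y Oy (fun k => Rlt_le_trans _ _ _ (n k) (Rmin_l _ _)).
have := H2 y Oy (fun k => Rlt_le_trans _ _ _ (n k) (Rmin_r _ _)).
by split_Rabs; lra.
Qed.

End Continuity.

Lemma closure_le d (K : pt d -> Prop) g a c : cont_on (fun _ => True) g ->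
  Defs.closure K c -> (forall p, K p -> g p <= a) -> g c <= a.
Proof.
move=> cg ad Ka; apply: Rnot_lt_le => lt.
have [|del [del0 H]] := cg c I (g c - a); first lra.
have [p [Kp np]] := ad del del0.
by have := H p I np; have := Ka p Kp; split_Rabs; lra.
Qed.

(** * Quadratic test functions *)

Lemma derivable_pt_lim_quadratic a b c :
  derivable_pt_lim (fun t => a + t * b + t * t * c) 0 b.
Proof.
move=> e e0; have d0 : 0 < e / (Rabs c + 1).
  by apply: Rdiv_lt_0_compat => //; have := Rabs_pos c; lra.
exists (mkposreal _ d0) => h h0 /= hh.
have -> : (a + (0 + h) * b + (0 + h) * (0 + h) * c - (a + 0 * b + 0 * 0 * c)) / h - b
    = h * c by field.
rewrite Rabs_mult; have := Rmult_lt_compat_r (Rabs c + 1) _ _ _ hh.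
have -> : e / (Rabs c + 1) * (Rabs c + 1) = e by field; have := Rabs_pos c; lra.
have := Rabs_pos c; have := Rabs_pos h => ? ? H; have := H ltac:(lra); lra.
Qed.

Lemma quad_shift d (w : pt d) t i (A : mat d) :
  quad (shift w t i) A = quad w A + t * (w *m (A + A^T))%ring ord0 i + t * t * A i i.
Proof.
have aux (a b c e : R) : a + t * b + (t * c + t * (t * e)) = a + t * (c + b) + t * t * e.
  by ring.
rewrite /quad /shift linearD linearZ /= trmx_delta mulmxDl mulmxDr !mulmxDl.
rewrite -!scalemxAl -!scalemxAr mulmxDr -!rowE -!colE !mxE.
have -> : (\sum_j row i A ord0 j * w^T j ord0 = \sum_j w ord0 j * A^T j i)%ring.
  by apply: eq_bigr => j _; rewrite !mxE; exact: Rmult_comm.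
exact: aux.
Qed.

Section QuadraticTest.
Context {d : nat} {Om : pt d -> Prop} (x : pt d) (k : 'I_d) (c a : R) (A : mat d).

(** The affine part involves the single coordinate [k], enough to interpolate linearly along a
    segment on which that coordinate varies. [A] is not assumed symmetric, hence [A + A^T] in the
    derivatives. *)
Definition quadratic (p : pt d) : R := c + a * (p ord0 k - x ord0 k) + quad (p - x)%ring A.
Definition Dquadratic (i : 'I_d) (p : pt d) : R :=
  (if k == i then a else 0) + ((p - x) *m (A + A^T))%ring ord0 i.
Definition D2quadratic (i j : 'I_d) (_ : pt d) : R := (A + A^T)%ring j i.

Lemma shift_sub (p : pt d) t i : (shift p t i - x)%ring = shift (p - x)%ring t i.
Proof. by rewrite /shift addrAC. Qed.

Lemma C2_on_quadratic : C2_on Om quadratic Dquadratic D2quadratic.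
Proof.
split; last split; last split; last split.
- apply: cont_on_plus (cont_on_quad _ _); apply: cont_on_plus; first exact: cont_on_const.
  apply: cont_on_mult; first exact: cont_on_const.
  by apply: cont_on_plus; [exact: cont_on_coord|exact: cont_on_const].
- by move=> i; apply: cont_on_plus; [exact: cont_on_const|exact: cont_on_affine].
- by move=> i j; exact: cont_on_const.
- move=> i p _; apply: derivable_pt_lim_ext (derivable_pt_lim_quadratic _ _ (A i i)).
  move=> t; rewrite /quadratic shift_sub quad_shift shift_coord /Dquadratic.
  (* The constant term left open by [derivable_pt_lim_quadratic] is the value at [p]. *)
  instantiate (1 := quadratic p); rewrite /quadratic; case: ifP => _; ring.
- move=> i j p _; apply: derivable_pt_lim_ext (derivable_pt_lim_quadratic _ _ 0).
  move=> t; rewrite /Dquadratic /D2quadratic shift_sub.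
  instantiate (1 := Dquadratic i p); rewrite /Dquadratic.
  have -> : (shift (p - x) t j *m (A + A^T))%ring ord0 i =
      ((p - x) *m (A + A^T))%ring ord0 i + t * (A + A^T)%ring j i.
    by rewrite /shift mulmxDl -scalemxAl -rowE !mxE.
  ring.
Qed.

Lemma quad_hessian_quadratic v p :
  quad v (hessian D2quadratic p) = 2 * quad v A.
Proof.
have -> : hessian D2quadratic p = (A + A^T)%ring.
  by apply/matrixP => i j; rewrite !mxE /D2quadratic !mxE; exact: Rplus_comm.
rewrite /quad mulmxDr mulmxDl mxE.
have -> : (v *m A^T *m v^T = (v *m A *m v^T)^T)%ring by rewrite !trmx_mul trmxK mulmxA.
rewrite [X in (_ + X)%ring]mxE; have aux (z : R) : z + z = 2 * z by ring.
exact: aux.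
Qed.

End QuadraticTest.

(** The test function is the chord of [u] plus [C * Q - e * s ^ 2], with [s] the parameter along the
    segment and [Q] a squared offset from its line. Its Hessian form at [v] is [- 2 * e], which
    [touch] forbids. *)
Lemma viscosity_convex d (Om : pt d -> Prop) u : is_open Om -> is_bounded Om ->
  (forall x y, Om x -> Om y -> forall t, 0 <= t <= 1 -> Om (lincomb t x (1 - t) y)) ->
  usc_on Om u ->
  (forall phi Dphi D2phi x, C2_on Om phi Dphi D2phi -> Om x ->
    loc_max Om (fun y => u y - phi y) x -> forall v, 0 <= quad v (hessian D2phi x)) ->
  convex_on Om u.
Proof.
move=> Hopen Hbd cvx usc touch x y Ox Oy t0 [t00 t01].
apply: Rnot_lt_le; set z := lincomb _ _ _ _ => lt.
have Oz : Om z by exact: cvx.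
have [v [yx vE]] : exists v : pt d, (y - x)%ring = v /\
    forall j, v ord0 j = y ord0 j - x ord0 j.
  by exists (y - x)%ring; split => // j; rewrite !mxE.
(* [lincomb] gives [x] the weight [t0], so [z] has parameter [1 - t0] counted from [x]. *)
pose tau := 1 - t0.
have zE j : z ord0 j = x ord0 j + tau * v ord0 j.
  by rewrite lincomb_coord vE /tau; ring.
have [k vk] : exists k, v ord0 k <> 0.
  apply: NNPP => no; have v0 j : v ord0 j = 0.
    by apply: NNPP => h; apply: no; exists j.
  have xy : y = x by apply: pt_ext => j; have := v0 j; rewrite vE; lra.
  have zx : z = x by apply: pt_ext => j; rewrite zE v0; lra.
  by move: lt; rewrite zx xy; lra.
(* An oblique coordinate, read off from one nonzero component of [v]; it is 0 at [x] and 1 at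
   [y]. *)
pose s (p : pt d) := (p ord0 k - x ord0 k) / v ord0 k.
(* [N] projects along [v]; it sends [p - x] to the part that the tube [K] bounds. *)
pose N : mat d := (1%:M - (v ord0 k)^-1 *: (delta_mx k ord0 *m v))%ring.
have perpE (p : pt d) j : ((p - x) *m N)%ring ord0 j = p ord0 j - x ord0 j - s p * v ord0 j.
  rewrite mulmxBr mulmx1 -scalemxAr mulmxA -colE !mxE big_ord1 !mxE.
  have aux (a b c e : R) : a - b - / e * ((p ord0 k - x ord0 k) * c) =
    a - b - (p ord0 k - x ord0 k) / e * c by rewrite /Rdiv; ring.
  exact: aux.
pose Q (p : pt d) := quad (p - x)%ring (N *m N^T)%ring.
have QE p : Q p = (\sum_j ((p - x) *m N)%ring ord0 j ^+ 2)%ring.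
  rewrite /Q /quad mulmxA -mulmxA -trmx_mul mxE; apply: eq_bigr => j _.
  by rewrite [X in (_ * X)%ring]mxE expr2.
have Q_ge (p : pt d) j : (p ord0 j - x ord0 j - s p * v ord0 j) ^ 2 <= Q p.
  rewrite QE -perpE -RexpE; apply/RleP; rewrite (bigD1 j) //= lerDl.
  by apply: sumr_ge0 => i _; exact: sqr_ge0.
have Q_ge0 p : 0 <= Q p.
  by have := Q_ge p k; have := pow2_ge_0 (p ord0 k - x ord0 k - s p * v ord0 k); lra.
have contQ P : cont_on P Q by exact: cont_on_quad.
have conts P : cont_on P s.
  apply: cont_on_mult (cont_on_const _).
  by apply: cont_on_plus; [exact: cont_on_coord|exact: cont_on_const].
have sz : s z = tau by rewrite /s zE; field.
have Qz : Q z = 0.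
  have pz j : ((z - x) *m N)%ring ord0 j = 0 :> R by rewrite perpE sz zE; ring.
  by rewrite QE big1 // => j _; rewrite pz expr0n.
have Qv : quad v (N *m N^T)%ring = 0.
  have sy : s y = 1 by rewrite /s -vE; field.
  have py j : ((y - x) *m N)%ring ord0 j = 0 :> R by rewrite perpE sy vE; ring.
  by rewrite -yx -/(Q y) QE big1 // => j _; rewrite py expr0n.
pose m := u z - (u x + tau * (u y - u x)).
have m0 : 0 < m by move: lt; rewrite /m /tau; lra.
(* On the end faces [u] exceeds its endpoint value by less than [e] and the concave term adds at
   most another [e], in total less than [m]. *)
pose e := m / 3; have e0 : 0 < e by rewrite /e; lra.
have [rx [rx0 Hrx]] := Hopen _ Ox; have [ry [ry0 Hry]] := Hopen _ Oy.
have [dx [dx0 Hdx]] := usc _ Ox _ e0; have [dy [dy0 Hdy]] := usc _ Oy _ e0.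
pose rho := Rmin (Rmin rx ry) (Rmin dx dy).
have rho0 : 0 < rho by do 2 apply: Rmin_glb_lt => //.
have l1 : rho <= rx by exact: Rle_trans (Rmin_l _ _) (Rmin_l _ _).
have l2 : rho <= ry by exact: Rle_trans (Rmin_l _ _) (Rmin_r _ _).
have l3 : rho <= dx by exact: Rle_trans (Rmin_r _ _) (Rmin_l _ _).
have l4 : rho <= dy by exact: Rle_trans (Rmin_r _ _) (Rmin_r _ _).
pose del := rho / 2; have del0 : 0 < del by rewrite /del; lra.
have del2 : 0 < del ^ 2 by exact: pow_lt.
pose K p := 0 <= s p <= 1 /\ Q p <= del ^ 2.
have perp_lt (p : pt d) j : K p -> Rabs (p ord0 j - x ord0 j - s p * v ord0 j) < rho.
  move=> [_ Qp]; have := Q_ge p j; set w := _ - _ - _ => h.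
  by apply: (Rle_lt_trans _ del); [apply: Rabs_le; split; nra|rewrite /del; lra].
(* [off q p] carries the transverse offset of [p] over to [q]. A point of the tube is a convex
   combination of its copies near [x] and near [y], which puts the tube inside [Om]. *)
pose off (q p : pt d) : pt d := (\row_j (q ord0 j + (p ord0 j - x ord0 j - s p * v ord0 j)%R))%ring.
have off_coord (q p : pt d) j :
    off q p ord0 j = q ord0 j + (p ord0 j - x ord0 j - s p * v ord0 j).
  by rewrite mxE.
have near_off q p r : K p -> rho <= r -> near q (off q p) r.
  move=> Kp rr j; rewrite off_coord; have := perp_lt p j Kp; split_Rabs; lra.
have KOm p : K p -> Om p.
  move=> Kp; have [[s0 s1] _] := Kp.
  have -> : p = lincomb (1 - s p) (off x p) (1 - (1 - s p)) (off y p).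
    by apply: pt_ext => j; rewrite lincomb_coord !off_coord vE; symmetry; ring.
  apply: cvx; last lra.
    by apply: Hrx; exact: near_off.
  by apply: Hry; exact: near_off.
have Kz : K z by rewrite /K sz Qz /tau; lra.
have Kbd : is_bounded K by have [B HB] := Hbd; exists B => p /KOm; exact: HB.
have Kcl c : Defs.closure K c -> K c.
  move=> ad; split; last by apply: closure_le ad _ => // p [].
  split; last by apply: closure_le ad _ => // p [[]].
  suff : -1 * s c <= 0 by lra.
  apply: (@closure_le _ _ (fun p => -1 * s p) _ _ _ ad) => [|p [[]]]; last lra.
  by apply: cont_on_mult => //; exact: cont_on_const.
have [c0 [_ Hc0]] := usc_attains_max usc KOm Kbd (ex_intro _ z Kz) Kcl.
(* On the lateral face [Q = del ^ 2], so the term [C * Q] cancels the largest possible value of [u]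
   minus the chord plus [e], and [u - phi] is at most 0 there. *)
pose C := (Rabs (u c0) + Rabs (u x) + Rabs (u y) + e) / del ^ 2.
have C0 : 0 <= C.
  apply: Rmult_le_pos; last exact/Rlt_le/Rinv_0_lt_compat.
  by have := Rabs_pos (u c0); have := Rabs_pos (u x); have := Rabs_pos (u y); lra.
have Cd : C * del ^ 2 = Rabs (u c0) + Rabs (u x) + Rabs (u y) + e.
  by rewrite /C; field; lra.
pose S : mat d := (C *: (N *m N^T) - (e / (v ord0 k) ^ 2)%R *: delta_mx k k)%ring.
have SE (w : pt d) : quad w S = C * quad w (N *m N^T)%ring - e * (w ord0 k / v ord0 k) ^ 2.
  rewrite /quad mulmxBr mulmxBl -!scalemxAr -!scalemxAl.
  have -> : (w *m delta_mx k k *m w^T)%ring = ((w ord0 k)^+2)%:M%ring.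
    rewrite -(mul_delta_mx (ord0 : 'I_1)) mulmxA -colE -mulmxA -rowE.
    by apply/matrixP => i j; rewrite !ord1 !mxE big_ord1 !mxE mulr1n expr2.
  rewrite !mxE mulr1n RexpE.
  have aux (b r : R) : C * b - e / v ord0 k ^ 2 * r ^ 2 = C * b - e * (r / v ord0 k) ^ 2.
    by field.
  exact: aux.
pose phi := quadratic x k (u x) ((u y - u x) / v ord0 k) S.
have phiE p : phi p = u x + s p * (u y - u x) + C * Q p - e * s p ^ 2.
  rewrite /phi /quadratic SE -/(Q p).
  have -> : (p - x)%ring ord0 k = p ord0 k - x ord0 k by rewrite !mxE.
  by rewrite /s; field.
have C2phi : C2_on Om phi _ _ := C2_on_quadratic x k (u x) ((u y - u x) / v ord0 k) S.
have uscd := usc_on_minus usc C2phi.1.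
have [c [Kc Hc]] := usc_attains_max uscd KOm Kbd (ex_intro _ z Kz) Kcl.
have Oc := KOm _ Kc.
have mc : m <= u c - phi c.
  apply: Rle_trans (Hc z Kz); rewrite phiE sz Qz.
  have := Rmult_le_pos _ _ (Rlt_le _ _ e0) (pow2_ge_0 tau); rewrite /m; lra.
have me : e + e < m by rewrite /e; lra.
have CQ : 0 <= C * Q c by exact: Rmult_le_pos.
have [[s0 s1] Qc] := Kc.
(* If [s c] were 0 or 1, then [c] would be its own copy near [x] or [y], where the semicontinuity
   bounds contradict [mc]. *)
have offE (q : pt d) : (forall j, q ord0 j = x ord0 j + s c * v ord0 j) -> off q c = c.
  by move=> qE; apply: pt_ext => j; rewrite off_coord qE; ring.
have sc0 : 0 < s c.
  case: s0 => // s0; exfalso.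
  have := Hdx _ Oc; rewrite -{1}(offE x) => [/(_ (near_off x c dx Kc l3))|j].
    by move: mc; rewrite phiE -s0; nra.
  by rewrite -s0; symmetry; ring.
have sc1 : s c < 1.
  case: s1 => // s1; exfalso.
  have := Hdy _ Oc; rewrite -{1}(offE y) => [/(_ (near_off y c dy Kc l4))|j].
    by move: mc; rewrite phiE s1; nra.
  by rewrite s1 vE; symmetry; ring.
have Qc1 : Q c < del ^ 2.
  case: Qc => // Qc; exfalso; move: mc; rewrite phiE Qc Cd.
  have := Hc0 c Kc; have := Rle_abs (u c0).
  have := Rmult_le_compat_l (1 - s c) _ _ ltac:(lra) (Rle_abs (- u x)).
  have := Rmult_le_compat_l (s c) _ _ ltac:(lra) (Rle_abs (- u y)).
  rewrite !Rabs_Ropp; have := Rabs_pos (u x); have := Rabs_pos (u y).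
  have : s c ^ 2 <= 1 by nra.
  by nra.
have : loc_max Om (fun p => u p - phi p) c.
  pose g := Rmin (Rmin (s c) (1 - s c)) (del ^ 2 - Q c).
  have g0 : 0 < g by do 2 (apply: Rmin_glb_lt; try lra).
  have g1 : g <= s c by exact: Rle_trans (Rmin_l _ _) (Rmin_l _ _).
  have g2 : g <= 1 - s c by exact: Rle_trans (Rmin_l _ _) (Rmin_r _ _).
  have g3 : g <= del ^ 2 - Q c by exact: Rmin_r.
  have [d1 [d10 H1]] := conts _ c Oc _ g0; have [d2 [d20 H2]] := contQ _ c Oc _ g0.
  exists (Rmin d1 d2); split; first exact: Rmin_glb_lt.
  move=> p Op np; apply: Hc.
  have := H1 p Op (fun j => Rlt_le_trans _ _ _ (np j) (Rmin_l _ _)).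
  have := H2 p Op (fun j => Rlt_le_trans _ _ _ (np j) (Rmin_r _ _)).
  by rewrite /K; split_Rabs; lra.
move=> /(touch _ _ _ _ C2phi Oc)/(_ v); rewrite quad_hessian_quadratic SE Qv.
have -> : v ord0 k / v ord0 k = 1 by field.
by lra.
Qed.

(** Points of [Om] lie in its closure; for equal points or [t] in [{0, 1}] the combination is one of
    the given points. *)
Lemma strictly_convex_lincomb d (Om : pt d -> Prop) x y t : strictly_convex Om ->
  Om x -> Om y -> 0 <= t <= 1 -> Om (lincomb t x (1 - t) y).
Proof.
move=> sc Ox Oy [t0 t1].
have cl z : Om z -> Defs.closure Om z.
  by move=> Oz e e0; exists z; split => // k; rewrite Rminus_diag Rabs_R0.
case: (excluded_middle_informative (x = y)) => [<-|xy].
  by have -> : lincomb t x (1 - t) x = x; first (apply: pt_ext => k; rewrite lincomb_coord; lra).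
case: t0 => [t0|<-]; last first.
  by have -> : lincomb 0 x (1 - 0) y = y; first (apply: pt_ext => k; rewrite lincomb_coord; lra).
case: t1 => [t1|->]; last first.
  by have -> : lincomb 1 x (1 - 1) y = x; first (apply: pt_ext => k; rewrite lincomb_coord; lra).
exact: sc (cl _ Ox) (cl _ Oy) xy _ _.
Qed.

Theorem theorem3p5 (d : nat) (Hd : (2 <= d)%nat) (Om : 'rV[R]_d -> Prop)
  (Hopen : is_open Om) (Hbdd : is_bounded Om) (Hsc : strictly_convex Om)
  (f : 'rV[R]_d -> R) (Hf : cont_on Om f) (Hf0 : forall x, Om x -> 0 <= f x)
  (u : 'rV[R]_d -> R)
  (Hu : visc_sol Om (fun A x => Hop A (f x)) u) :
  visc_sol_cvx Om (fun A x => Mop A (f x)) u.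
Proof.
have d0 : (0 < d)%nat by exact: ltnW.
case: Hu => -[usc sub] [lsc super].
have cvx : convex_on Om u.
  apply: viscosity_convex => // [x y Ox Oy t|phi Dphi D2phi x C2 Ox tx].
    exact: strictly_convex_lincomb.
  exact: Hop_le0_quad d0 (Hf0 x Ox) (sub _ _ _ _ C2 Ox tx).
split; split => //; split => // phi Dphi D2phi x C2 phi_cvx Ox tx.
  apply: Mop_le0 => //; first exact: Hf0.
    exact: hessian_sym C2 Ox.
  exact: sub C2 Ox tx.
(* The sign of the Hessian cannot come from [0 <= Hop], so it is taken from the convexity of
   [phi]. *)
apply: Mop_ge0 => //; first exact: Hf0.
  exact: convex_hessian_psd C2 phi_cvx Ox.
exact: super C2 Ox tx.
Qed.
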